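(* Let $3\le n\le\infty$ and let $\Gamma\le\mathrm{Sym}(n)$. If $\Gamma$ is discrete in $\mathrm{Sym}(n)$ (for the topology of pointwise convergence), then there is a unique topology on the kaleidoscopic group $\mathcal{K}(\Gamma)$ for which it is a Polish group.
   Context: A dendrite is a locally connected continuum (non-empty compact connected metrizable space) containing no simple closed curve. Any two distinct points $x,y$ of a dendrite $X$ are joined by a unique arc $[x,y]$; put $(x,y)=[x,y]\setminus\{x,y\}$. For $x\in X$, $\widehat{x}=\pi_0(X\setminus\{x\})$ is the (at most countable) set of components of $X\setminus\{x\}$; $x$ is a branch point if $|\widehat{x}|\ge 3$, and $\mathrm{Br}(X)$ is the (at most countable) set of branch points. For $3\le n\le\infty$ ($\infty$ meaning countably infinite), the Ważewski dendrite $D_n$ is the dendrite, unique up to homeomorphism, which is not a single point, in which $|\widehat{x}|=n$ for every branch point $x$, and in which $(x,y)$ contains a branch point for all $x\ne y$. Write $[n]=\{m\in\mathbf{N}: m<n\}$ (so $[\infty]=\mathbf{N}\ni 0$) and $\mathrm{Sym}(n)$ for the group of all permutations of $[n]$, with the topology of pointwise convergence. A coloring of $D_n$ is a map $c$ from $\widehat{D_n}=\bigsqcup_{x\in\mathrm{Br}(D_n)}\widehat{x}$ to $[n]$ whose restriction $c_x=c|_{\widehat{x}}$ is a bijection $\widehat{x}\to[n]$ for each $x\in \mathrm{Br}(D_n)$; for $y\ne x$, $c_x(y)$ denotes the color of the component of $D_n\setminus\{x\}$ containing $y$. The coloring is kaleidoscopic if for all distinct $x,y\in\mathrm{Br}(D_n)$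 and all distinct $i,j\in[n]$ there is $z\in(x,y)\cap\mathrm{Br}(D_n)$ with $c_z(x)=i$ and $c_z(y)=j$. For $g\in\mathrm{Homeo}(D_n)$ and $x\in\mathrm{Br}(D_n)$ put $\sigma_c(g,x)=c_{g(x)}\circ g\circ c_x^{-1}\in\mathrm{Sym}(n)$, where $g$ is viewed as a bijection $\widehat{x}\to\widehat{g(x)}$. For $\Gamma\le\mathrm{Sym}(n)$ put $\mathcal{K}_c(\Gamma)=\{g\in\mathrm{Homeo}(D_n):\sigma_c(g,x)\in\Gamma\ \text{for all } x\in\mathrm{Br}(D_n)\}$. Kaleidoscopic colorings exist and for any two of them, $c$ and $d$, the groups $\mathcal{K}_c(\Gamma)$ and $\mathcal{K}_d(\Gamma)$ are conjugate in $\mathrm{Homeo}(D_n)$; $\mathcal{K}(\Gamma)$ denotes $\mathcal{K}_c(\Gamma)$ for some (any) kaleidoscopic coloring $c$. A Polish group is a topological group whose topology is separable and completely metrizable. *)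

(* Defs.v *)
From HB Require Import structures.
From mathcomp Require Import all_boot all_order all_algebra.
From mathcomp Require Import all_classical all_reals all_analysis.
Import Order.TTheory GRing.Theory Num.Theory.
Import numFieldNormedType.Exports.

Set Implicit Arguments.
Unset Strict Implicit.
Unset Printing Implicit Defensive.

Local Open Scope classical_set_scope.
Local Open Scope ring_scope.

Section Bijection.
Context {A B : Type}.

Record bijection := Bijection {
  bij_fun :> A -> B;
  bij_inv : B -> A;
  bij_funK : cancel bij_fun bij_inv;
  bij_invK : cancel bij_inv bij_fun }.

Lemma bijectionP (f g : bijection) : f =1 g -> f = g.
Proof.
case: f g => f f' fK f'K [g g' gK g'K] /= fg.
have {}fg : f = g by apply/funext.
subst g; have f'g' : f' = g'.
  by apply/funext => y; rewrite -{1}[y]g'K fK.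
by subst g'; congr Bijection; exact: Prop_irrelevance.
Qed.

End Bijection.
Arguments bijection : clear implicits.

HB.instance Definition _ (A B : Type) := gen_eqMixin (bijection A B).
HB.instance Definition _ (A B : Type) := gen_choiceMixin (bijection A B).

Definition bij_id (A : Type) : bijection A A :=
  @Bijection A A id id (fun=> erefl) (fun=> erefl).

Definition bij_sym (A B : Type) (f : bijection A B) : bijection B A :=
  Bijection (bij_invK f) (bij_funK f).

Definition bij_comp (A B C : Type) (g : bijection B C) (f : bijection A B) :
    bijection A C :=
  @Bijection A C (g \o f) (bij_inv f \o bij_inv g)
    (can_comp (bij_funK g) (bij_funK f)) (can_comp (bij_invK f) (bij_invK g)).

Section BijectionGroup.
Variable A : Type.
Implicit Types f g h : bijection A A.

Let bij_compA : associative (@bij_comp A A A).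
Proof. by move=> f g h; exact: bijectionP. Qed.
Let bij_comp1l : left_id (bij_id A) (@bij_comp A A A).
Proof. by move=> f; exact: bijectionP. Qed.
Let bij_comp1r : right_id (bij_id A) (@bij_comp A A A).
Proof. by move=> f; exact: bijectionP. Qed.
Let bij_compVl : left_inverse (bij_id A) (@bij_sym A A) (@bij_comp A A A).
Proof. by move=> f; apply: bijectionP => x /=; rewrite bij_funK. Qed.
Let bij_compVr : right_inverse (bij_id A) (@bij_sym A A) (@bij_comp A A A).
Proof. by move=> f; apply: bijectionP => x /=; rewrite bij_invK. Qed.

HB.instance Definition _ := isGroup.Build (bijection A A)
  bij_compA bij_comp1l bij_comp1r bij_compVl bij_compVr.

End BijectionGroup.

Definition subgroup_of (G : groupType) (H : groupClosed G) : Type :=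
  {g : G | g \in H}.

Section SubgroupOf.
Variables (G : groupType) (H : groupClosed G).

Let H_group_closed : group_closed H.
Proof. by split=> [|x y Hx Hy]; [exact: gpred1|exact: gpredF]. Qed.

HB.instance Definition _ := SubChoice.on (subgroup_of H).
HB.instance Definition _ :=
  SubChoice_isSubGroup.Build G (mem H) (subgroup_of H) H_group_closed.

End SubgroupOf.

Definition homeomorphism (S T : topologicalType) (h : bijection S T) :=
  continuous h /\ continuous (bij_inv h).

Definition homeomorphic (S T : topologicalType) :=
  exists h : bijection S T, homeomorphism h.

Section Metrizability.
Variables (R : realType) (T : topologicalType).

Definition metrizable := exists M : metricType R, homeomorphic T M.

Definition completely_metrizable := exists2 M : metricType R,
  homeomorphic T M &
  forall F : set_system M, ProperFilter F -> cauchy F -> exists l : M, F --> l.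

Definition separable := exists2 D : set T, countable D & dense D.

End Metrizability.

Section Dendrite.
Variables (R : realType) (X : topologicalType).

Definition locally_connected := forall (x : X) (U : set X), nbhs x U ->
  exists V : set X, [/\ open V, V x, connected V & V `<=` U].

Definition unit_circle : set (R * R) := [set p | p.1 ^+ 2 + p.2 ^+ 2 = 1].

Definition simple_closed_curve (A : set X) := homeomorphic A unit_circle.

Definition dendrite := [/\ [set: X] !=set0, compact [set: X],
  connected [set: X] & metrizable R X] /\
  [/\ locally_connected & forall A : set X, ~ simple_closed_curve A].

Definition unit_interval : set R := `[0, 1].

Definition is_arc (x y : X) (A : set X) :=
  exists2 h : bijection unit_interval A, homeomorphism h &
    forall t, (val t = 0 -> val (h t) = x) /\ (val t = 1 -> val (h t) = y).

(* The arc [x, y] for x <> y; meaningful when there is exactly one arc joining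
   x to y, as in a dendrite. *)
Definition arc (x y : X) : set X := xget set0 (is_arc x y).

Definition open_arc (x y : X) : set X := arc x y `\` [set x; y].

End Dendrite.

(* n : option nat ranges over the naturals and oo; None stands for oo. *)
Definition bracket (n : option nat) : set nat :=
  if n is Some k then `I_k else setT.

Section Components.
Variable X : topologicalType.

Definition hat (x : X) : set (set X) :=
  [set connected_component (~` [set x]) y | y in ~` [set x]].

Definition branch_points : set X := [set x | `I_3 #<= hat x]%card.

Lemma component_in_hat (x y : X) (yx : y <> x) :
  connected_component (~` [set x]) y \in hat x.
Proof. by rewrite inE; exists y. Qed.

Definition component_at (x y : X) (yx : y <> x) : hat x :=
  exist (fun C => C \in hat x) _ (component_in_hat yx).

End Components.

Definition wazewski_dendrite (R : realType) (n : option nat)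
    (X : topologicalType) :=
  [/\ dendrite R X, exists x y : X, x <> y,
      forall x : X, branch_points x -> (hat x #= bracket n)%card &
      forall x y : X, x <> y -> open_arc R x y `&` @branch_points X !=set0].

Definition homeo_set (X : topologicalType) : {pred bijection X X} :=
  fun g => `[< homeomorphism g >].

Section HomeoGroup.
Variable X : topologicalType.

Let homeo_group_closed : group_closed (@homeo_set X).
Proof.
split; first by apply/asboolP; split=> x; exact: cvg_id.
move=> f g /asboolP[cf cf'] /asboolP[cg cg']; apply/asboolP; split=> x /=.
  by apply: (@continuous_comp X X X); [exact: cg'|exact: cf].
by apply: (@continuous_comp X X X); [exact: cf'|exact: cg].
Qed.

HB.instance Definition _ :=
  isMulClosed.Build _ (@homeo_set X) (group_closedM homeo_group_closed).
HB.instance Definition _ :=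
  isMul1Closed.Build _ (@homeo_set X) homeo_group_closed.1.
HB.instance Definition _ :=
  isInvClosed.Build _ (@homeo_set X) (group_closedV homeo_group_closed).

End HomeoGroup.

Definition Homeo (X : topologicalType) : Type := subgroup_of (@homeo_set X).

HB.instance Definition _ (X : topologicalType) := SubGroup.on (Homeo X).

Definition homeo_fun (X : topologicalType) (g : Homeo X) : bijection X X :=
  val g.
Coercion homeo_fun : Homeo >-> bijection.

Section LocalAction.
Variable X : topologicalType.
Implicit Types (g h : Homeo X) (x y : X).

Lemma homeo_continuous g : continuous g.
Proof. by have /asboolP[] := valP g. Qed.

Lemma homeo_inv_continuous g : continuous (bij_inv g).
Proof. by have /asboolP[] := valP g. Qed.

Lemma homeo_setC1 g x : g @` (~` [set x]) = ~` [set g x].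
Proof.
apply/seteqP; split=> [_ [y yx <-] e|y yx].
  by apply: yx; exact: (can_inj (bij_funK g) e).
exists (bij_inv g y); last exact: bij_invK.
by move=> e; apply: yx; rewrite -e /= bij_invK.
Qed.

Lemma homeo_component_sub g x y :
  g @` connected_component (~` [set x]) y `<=`
  connected_component (~` [set g x]) (g y).
Proof.
move=> _ [z [C [Cy Cx cC] Cz] <-]; exists (g @` C); last by exists z.
split; first by exists y.
- by rewrite -homeo_setC1; exact: image_subset.
- apply: connected_continuous_connected => //.
  by apply: continuous_subspaceT; exact: homeo_continuous.
Qed.

Lemma homeo_component g x y :
  g @` connected_component (~` [set x]) y =
  connected_component (~` [set g x]) (g y).
Proof.
apply/seteqP; split; first exact: homeo_component_sub.
move=> z gz; exists (bij_inv g z); last exact: bij_invK.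
have := @homeo_component_sub (g^-1)%g (g x) (g y) (bij_inv g z).
rewrite /= !bij_funK; apply; by exists z.
Qed.

Lemma hat_image g x C : C \in hat x -> g @` C \in hat (g x).
Proof.
rewrite !inE => -[y yx <-]; exists (g y); last by rewrite homeo_component.
by move=> e; apply: yx; exact: (can_inj (bij_funK g) e).
Qed.

Lemma hat_image_inv g x C : C \in hat (g x) -> bij_inv g @` C \in hat x.
Proof. by move=> gC; have := hat_image (g^-1)%g gC; rewrite /= bij_funK. Qed.

Definition homeo_hat_fun g x (C : hat x) : hat (g x) :=
  exist (fun C => C \in hat (g x)) _ (hat_image g (valP C)).

Definition homeo_hat_inv g x (C : hat (g x)) : hat x :=
  exist (fun C => C \in hat x) _ (hat_image_inv (valP C)).

Lemma homeo_hat_funK g x : cancel (@homeo_hat_fun g x) (@homeo_hat_inv g x).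
Proof.
move=> C; apply: val_inj => /=; rewrite image_comp.
by rewrite (_ : _ \o _ = id) ?image_id//; apply/funext => y; exact: bij_funK.
Qed.

Lemma homeo_hat_invK g x : cancel (@homeo_hat_inv g x) (@homeo_hat_fun g x).
Proof.
move=> C; apply: val_inj => /=; rewrite image_comp.
by rewrite (_ : _ \o _ = id) ?image_id//; apply/funext => y; exact: bij_invK.
Qed.

(* C |-> g(C) *)
Definition homeo_hat g x : bijection (hat x) (hat (g x)) :=
  Bijection (@homeo_hat_funK g x) (@homeo_hat_invK g x).

Lemma homeo_branch_subproof g (x : @branch_points X) :
  g (val x) \in @branch_points X.
Proof.
have : (hat (val x) #<= hat (g (val x)))%card.
  have inj_f : set_inj [set: hat (val x)] (@homeo_hat_fun g (val x)).
    by move=> ? ? _ _; exact: (can_inj (@homeo_hat_funK g (val x))).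
  by apply/card_leP/injfunPex; exists (@homeo_hat_fun g (val x)).
case: x => x /=; rewrite !inE; exact: card_le_trans.
Qed.

Definition homeo_branch g (x : @branch_points X) : @branch_points X :=
  exist (fun y => y \in @branch_points X) _ (homeo_branch_subproof g x).

End LocalAction.

Definition sym (n : option nat) : Type := bijection (bracket n) (bracket n).

HB.instance Definition _ (n : option nat) := Group.on (sym n).

HB.instance Definition _ (n : option nat) := Topological.copy (sym n)
  (initial_topology (fun s : sym n =>
     (s : bracket n -> bracket n) :
       {ptws bracket n -> discrete_topology (bracket n)})).

Definition discrete_subset (T : topologicalType) (A : set T) :=
  A `<=` isolated A.

Definition coloring (n : option nat) (X : topologicalType) : Type :=
  forall x : @branch_points X, bijection (hat (val x)) (bracket n).

Definition color_at (n : option nat) (X : topologicalType) (c : coloring n X)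
    (x : @branch_points X) (y : X) (yx : y <> val x) : bracket n :=
  c x (component_at yx).

Definition kaleidoscopic (R : realType) (n : option nat) (X : topologicalType)
    (c : coloring n X) :=
  forall x y : @branch_points X, x <> y ->
  forall i j : bracket n, i <> j ->
  exists z : @branch_points X, open_arc R (val x) (val y) (val z) /\
  exists (xz : val x <> val z) (yz : val y <> val z),
    color_at c xz = i /\ color_at c yz = j.

Section KaleidoscopicGroup.
Variables (n : option nat) (X : topologicalType) (c : coloring n X).
Implicit Types (g h : Homeo X) (x : @branch_points X).

(* c_(g x) o g o c_x^-1 *)
Definition sigma g x : sym n :=
  bij_comp (c (homeo_branch g x))
    (bij_comp (homeo_hat g (val x)) (bij_sym (c x))).

Definition kaleidoscopic_set (Gamma : groupClosed (sym n)) :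
    {pred Homeo X} :=
  fun g => `[< forall x, sigma g x \in Gamma >].

Lemma coloring_eq x y (C : hat (val x)) (D : hat (val y)) :
  x = y -> val C = val D -> c x C = c y D.
Proof. by move=> xy; subst y => /val_inj ->. Qed.

Lemma sigma1 x : sigma 1%g x = 1%g.
Proof.
apply: bijectionP => i /=; rewrite -[RHS](bij_invK (c x)).
apply: (@coloring_eq (homeo_branch 1%g x)); first exact: val_inj.
by rewrite /= image_id.
Qed.

Lemma sigmaM g h x :
  sigma (g * h)%g x = (sigma g (homeo_branch h x) * sigma h x)%g.
Proof.
apply: bijectionP => i /=; rewrite bij_funK.
apply: (@coloring_eq (homeo_branch (g * h)%g x)
                     (homeo_branch g (homeo_branch h x))).
  exact: val_inj.
exact/esym/image_comp.
Qed.

Lemma sigmaV g x :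
  sigma (g^-1)%g x = ((sigma g (homeo_branch (g^-1)%g x))^-1)%g.
Proof.
apply: (@mulgI _ (sigma g (homeo_branch (g^-1)%g x))).
by rewrite -sigmaM mulgV mulgV sigma1.
Qed.

Variable Gamma : groupClosed (sym n).

Let kaleidoscopic_group_closed : group_closed (kaleidoscopic_set Gamma).
Proof.
split; first by apply/asboolP => x; rewrite sigma1 gpred1.
move=> g h /asboolP Gg /asboolP Gh; apply/asboolP => x.
by rewrite sigmaM gpredM// sigmaV gpredV.
Qed.

HB.instance Definition _ := isMulClosed.Build _ (kaleidoscopic_set Gamma)
  (group_closedM kaleidoscopic_group_closed).
HB.instance Definition _ := isMul1Closed.Build _ (kaleidoscopic_set Gamma)
  kaleidoscopic_group_closed.1.
HB.instance Definition _ := isInvClosed.Build _ (kaleidoscopic_set Gamma)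
  (group_closedV kaleidoscopic_group_closed).

Definition kaleidoscopic_group : Type := subgroup_of (kaleidoscopic_set Gamma).

HB.instance Definition _ := SubGroup.on kaleidoscopic_group.

End KaleidoscopicGroup.

Section TopologyOn.
Variable T : choiceType.

Record topology_on := TopologyOn {
  top_open : set_system T;
  top_openT : top_open setT;
  top_openI : setI_closed top_open;
  top_open_bigU : forall F : set_system T,
    F `<=` top_open -> top_open (\bigcup_(A in F) A) }.

Lemma topology_onP (tau tau' : topology_on) :
  top_open tau = top_open tau' -> tau = tau'.
Proof.
case: tau tau' => [op ? ? ?] [op' ? ? ?] /= e; subst op'.
by congr TopologyOn; exact: Prop_irrelevance.
Qed.

(* T equipped with the topology tau, whatever other topology T may carry. *)
Definition with_topology (tau : topology_on) : Type := T.

Variable tau : topology_on.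

HB.instance Definition _ := Choice.on (with_topology tau).

Let top_open_bigcup (I : Type) (f : I -> set T) :
  (forall i, top_open tau (f i)) -> top_open tau (\bigcup_i f i).
Proof.
move=> fo; have -> : \bigcup_i f i = \bigcup_(A in range f) A.
  by rewrite bigcup_image.
by apply: top_open_bigU => _ [i _ <-].
Qed.

HB.instance Definition _ := isOpenTopological.Build (with_topology tau)
  (top_openT tau) (@top_openI tau) top_open_bigcup.

End TopologyOn.

HB.instance Definition _ (G : groupType) (tau : topology_on G) :=
  Group.copy (with_topology tau) G.

Definition polish_group_topology (R : realType) (G : groupType)
    (tau : topology_on G) :=
  let T := with_topology tau in
  [/\ continuous (fun p : T * T => (p.1 * p.2)%g : T),
      continuous (fun g : T => (g^-1)%g : T),
      separable T & completely_metrizable R T].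

(* Main.v *)
(* Let V be the countable set of branch points and G = K(Gamma).

   Existence: branch points separate points, so the half-spaces (components of
   X \ {v}, v in V) generate the topology of X, and a permutation of V which
   preserves separation extends to a homeomorphism.  Hence G, with pointwise
   convergence on V, is closed in Sym(V): as Gamma is discrete, the local
   actions at a given v of a convergent sequence in G are eventually constant.

   Uniqueness: let C be a half-space at v and Fix(C) its pointwise stabilizer
   in G.  Arbitrarily small half-spaces support nontrivial elements of G (built
   by back and forth on V, where medians turn a finite set of branch points
   into a finite tree).  So Fix(C) is the centralizer of the group of elements
   supported in C, and its normalizer fixes v.  In a Polish group topology this
   normalizer is closed and of countable index, hence open.  Therefore every
   Polish group topology on G refines the pointwise one, and comparable Polish
   group topologies coincide (open mapping theorem). *)

Require Import Defs.
From HB Require Import structures.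
From mathcomp Require Import all_boot all_order all_algebra.
From mathcomp Require Import all_classical all_reals all_analysis.
Import Order.TTheory GRing.Theory Num.Theory.
Import numFieldNormedType.Exports.

Set Implicit Arguments.
Unset Strict Implicit.
Unset Printing Implicit Defensive.

Local Open Scope classical_set_scope.

(** * Back and forth on coloured trees *)

(** [Gamma] may be trivial, so the elements supported in half-spaces are built with trivial local
    action everywhere: they come from bijections of the branch points preserving all colours. A
    finite partial map is kept closed under medians because a new point is then attached at a point
    or inside an edge of a finite tree, and its colours relative to one or two neighbours determine
    those relative to all the other points. The detour through fixators of half-spaces makes a point
    stabilizer accessible to an unknown topology: commuting with a given element is a closed
    condition in every Hausdorff group topology. The dendrite is handled through the components of
    complements of points; arcs enter only in the proof that branch points separate points. *)

Lemma sub_in_count_lt (T : eqType) (a b : pred T) (s : seq T) (x : T) :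
  {in s, forall y, a y -> b y} -> x \in s -> b x -> ~~ a x ->
  count a s < count b s.
Proof.
move=> ab xs bx nax; rewrite !(permP (perm_to_rem xs)) /= bx (negbTE nax).
rewrite add0n add1n ltnS.
have -> : count a (rem x s) = count (predI a b) (rem x s).
  apply: eq_in_count => y /mem_rem ys /=.
  by case ay: (a y) => //=; rewrite (ab y ys ay).
by apply: sub_count => y /andP[].
Qed.

(* [V] plays the role of the branch points, and [col v u] of the colour of the
   component of the complement of [v] containing [u], with [col v v = None]. *)
Section BackAndForth.
Variables (V I : eqType) (col : V -> V -> option I).
Implicit Types (u v w a b m z : V) (s : seq (V * V)).

(* [m] lies on the closed interval between [a] and [b]. *)

Definition btw a m b := (col m a == col m b) ==> (m == a).

Definition med m a b c := [&& btw a m b, btw b m c & btw a m c].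

Hypothesis colE : forall u v, (col u v == None) = (u == v).
Hypothesis col_sep : forall u v w,
  u != v -> col u v != col u w -> col v u = col v w.
Hypothesis col_med : forall a b c, exists m, med m a b c.
Hypothesis col_kal : forall u v i j, u != v -> i != j ->
  exists z, col z u = Some i /\ col z v = Some j.
Hypothesis col_surj : forall u i, exists v, col u v = Some i.
Hypothesis col_two : forall i : I, exists j, j != i.

Let colxx u : col u u = None.
Proof. by apply/eqP; rewrite colE. Qed.

Let btwC a m b : btw a m b = btw b m a.
Proof.
rewrite /btw [col m b == _]eq_sym; case: eqP => //= e.
by rewrite -!colE e.
Qed.

Let btwP a m b : btw a m b -> m != b -> col m a != col m b.
Proof. by rewrite btwC /btw eq_sym => /implyP h; apply: contra => /h. Qed.

Let btw_l a b : btw a a b.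
Proof. by rewrite /btw eqxx implybT. Qed.

Let btw_r a b : btw a b b.
Proof. by rewrite btwC btw_l. Qed.

Let medC12 m a b c : med m a b c = med m b a c.
Proof. by rewrite /med btwC; case: btw; case: btw; case: btw. Qed.

Let medC23 m a b c : med m a b c = med m a c b.
Proof. by rewrite /med (btwC b); case: btw; case: btw; case: btw. Qed.

Let btw_sub a p b q : p != a -> btw a p b -> btw p q b -> btw a q b.
Proof.
move=> pa apb pqb; apply/implyP => /eqP e; apply: contraT => qa.
have qb : q != b by rewrite -colE -e colE.
have qp := btwP pqb qb.
have [eqp|nqp] := eqVneq q p.
  move/implyP: apb; rewrite -eqp e eqxx => /(_ isT) /eqP qa'.
  by rewrite qa' eqxx in qa.
have /col_sep := qp => /(_ nqp) e1.
have /col_sep : col q p != col q a by rewrite e.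
move=> /(_ nqp) e2.
by move/implyP: apb; rewrite -e1 -e2 eqxx (negbTE pa) => /(_ isT).
Qed.

(* [a] is the point of the edge [a, a'] at which [p] is attached, and [b] is
   interior to that edge. *)
Let col_edge b a a' p : a != b -> col b a != col b a' -> btw p a a' ->
  col b p = col b a /\ col p b = col p a'.
Proof.
move=> ab baa' paa'.
have ba : b != a by rewrite eq_sym.
have e1 := col_sep ba baa'.
have [->|pa] := eqVneq p a; first by split.
have aa' : a != a' by apply: contraNneq baa' => ->.
have n2 : col a b != col a p by rewrite e1 eq_sym; exact: btwP.
have e3 := col_sep ab n2.
split=> //; apply: col_sep; last by rewrite -e3.
by rewrite -colE -e3 colE.
Qed.

Let col_leaf m b p : m != b -> col m p != col m b ->
  col b p = col b m /\ (p != m -> col p b = col p m).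
Proof.
move=> mb n; split; first by apply/esym/col_sep => //; rewrite eq_sym.
by move=> pm; apply/esym/col_sep => //; rewrite eq_sym.
Qed.

(** A finite partial map is a list of pairs, so that exchanging the components turns an extension of
    the domain into one of the range. *)
Definition piso s := {in s &, forall p q, col p.1 q.1 = col p.2 q.2}.

(** Only first components are mentioned: [piso] transports betweenness, hence medians, to the second
    ones. *)
Definition mcl s := forall p q r, p \in s -> q \in s -> r \in s ->
  exists2 m, m \in s & med m.1 p.1 q.1 r.1.

Let piso_eq s p q : piso s -> p \in s -> q \in s -> (p.1 == q.1) = (p.2 == q.2).
Proof. by move=> si ps qs; rewrite -!colE si. Qed.

Let piso_btw s p q r : piso s -> p \in s -> q \in s -> r \in s ->
  btw p.1 q.1 r.1 = btw p.2 q.2 r.2.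
Proof. by move=> si ps qs rs; rewrite /btw !si// (piso_eq si qs ps). Qed.

(** A triple in which [b] occurs twice has median [b], which leaves the triples with a single
    [b]. *)
Let mcl_cons b b' s : mcl s ->
  (forall p q, p \in s -> q \in s ->
    exists2 m, m \in (b, b') :: s & med m.1 b p.1 q.1) ->
  mcl ((b, b') :: s).
Proof.
move=> sm sb.
have sbb c : exists2 m, m \in (b, b') :: s & med m.1 b b c.
  by exists (b, b'); rewrite ?mem_head//= /med !btw_l.
have w (t : V * V) : (exists2 m, m \in s & med m.1 b t.1 t.1) ->
    exists2 m, m \in (b, b') :: s & med m.1 b t.1 t.1.
  by move=> [m ms mm]; exists m => //; rewrite inE ms orbT.
have swap1 a c d : (exists2 m, m \in (b, b') :: s & med m.1 a c d) ->
    exists2 m, m \in (b, b') :: s & med m.1 c a d.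
  by move=> [m ms mm]; exists m => //; rewrite medC12.
have swap2 a c d : (exists2 m, m \in (b, b') :: s & med m.1 a c d) ->
    exists2 m, m \in (b, b') :: s & med m.1 a d c.
  by move=> [m ms mm]; exists m => //; rewrite medC23.
move=> p q r; rewrite !inE.
move=> /predU1P[->|ps] /predU1P[->|qs] /predU1P[->|rs] /=.
- exact: sbb.
- exact: sbb.
- exact/swap2/sbb.
- exact: sb.
- exact/swap1/swap2/sbb.
- exact/swap1/sb.
- exact/swap2/swap1/sb.
- by have [m ms mm] := sm _ _ _ ps qs rs; exists m => //; rewrite inE ms orbT.
Qed.

Let piso_cons b b' s : piso s ->
  {in s, forall p, col b p.1 = col b' p.2 /\ col p.1 b = col p.2 b'} ->
  piso ((b, b') :: s).
Proof.
move=> si sb p q; rewrite !inE => /predU1P[->|ps] /predU1P[->|qs] /=.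
- by rewrite !colxx.
- by have [] := sb q qs.
- by have [] := sb p ps.
- exact: si.
Qed.

(** Here [b] lies between [p0] and [q0]. A further point of [s] between them splits the interval,
    [b] stays inside one half, and passing to that half loses an endpoint, so fewer points of [s]
    remain in it. *)
Let adjacent_pair s b p0 q0 : p0 \in s -> q0 \in s ->
  {in s, forall p, b != p.1} -> col b p0.1 != col b q0.1 ->
  exists p q, [/\ p \in s, q \in s, col b p.1 != col b q.1 &
    {in s, forall r, btw p.1 r.1 q.1 -> r.1 = p.1 \/ r.1 = q.1}].
Proof.
move=> + + sb; have [k] := ubnP (count (fun r => btw p0.1 r.1 q0.1) s).
elim: k p0 q0 => // k IH p0 q0 + p0s q0s pq.
rewrite ltnS => le_k.
have [[r rs]|no] := pselect (exists2 r, r \in s &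
    [&& btw p0.1 r.1 q0.1, r.1 != p0.1 & r.1 != q0.1]); last first.
  exists p0, q0; split=> // r rs brs.
  have [->|r1] := eqVneq r.1 p0.1; first by left.
  have [->|r2] := eqVneq r.1 q0.1; first by right.
  by case: no; exists r => //; rewrite brs r1 r2.
move=> /and3P[brs r1 r2].
have [brp|brq] := eqVneq (col b r.1) (col b p0.1).
  apply: (IH r q0) => //; last by rewrite brp.
  apply: leq_trans le_k; apply: (@sub_in_count_lt _ _ _ _ p0) => //=.
    by move=> t ts; exact: btw_sub.
  rewrite /btw negb_imply [p0.1 == _]eq_sym r1 andbT; apply/eqP.
  by apply: col_sep => //; apply: btwP.
apply: (IH p0 r) => //; last by rewrite eq_sym.
apply: leq_trans le_k; apply: (@sub_in_count_lt _ _ _ _ q0) => //=.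
- move=> t ts; rewrite btwC => h; rewrite btwC; apply: btw_sub h => //.
  by rewrite btwC.
- rewrite btwC /btw negb_imply [q0.1 == _]eq_sym r2 andbT; apply/eqP.
  by apply: col_sep => //; rewrite eq_sym; apply: btwP.
Qed.

(** The image [b'] is put between the images of the ends [p], [q] of the edge containing [b], with
    the same two colours. The median of [p], [q] and any other point of [s] is in [s], hence is [p]
    or [q]; so [col_edge] yields the colours between that point and [b], and likewise for the
    images. *)
Let extend_edge s b p0 q0 : piso s -> mcl s -> p0 \in s -> q0 \in s ->
  {in s, forall p, b != p.1} -> col b p0.1 != col b q0.1 ->
  exists b', piso ((b, b') :: s) /\ mcl ((b, b') :: s).
Proof.
move=> si sm p0s q0s sb.
move=> /(adjacent_pair p0s q0s sb)[p [q [ps qs pq adj]]] {p0 q0 p0s q0s}.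
case ei: (col b p.1) pq => [i|] pq; last first.
  by move/eqP: ei; rewrite colE (negbTE (sb p ps)).
case ej: (col b q.1) pq => [j|] pq; last first.
  by move/eqP: ej; rewrite colE (negbTE (sb q qs)).
have ij : i != j by apply: contraNneq pq => ->.
have pq2 : p.2 != q.2.
  by rewrite -(piso_eq si ps qs); apply: contraNneq ij => e; apply/eqP;
    move: ei; rewrite e ej => -[].
have [b' [b'p b'q]] := col_kal pq2 ij; exists b'.
have pb' : p.2 != b' by rewrite eq_sym -colE b'p.
have qb' : q.2 != b' by rewrite eq_sym -colE b'q.
have pb : p.1 != b by rewrite eq_sym sb.
have qb : q.1 != b by rewrite eq_sym sb.
split.
  apply: piso_cons => // r rs.
  have [m ms /and3P[rmp pmq rmq]] := sm _ _ _ rs ps qs.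
  have [em|em] := adj m ms pmq.
    have em2 : m.2 = p.2 by apply/eqP; rewrite -(piso_eq si ms ps) em.
    have rpq : btw r.1 p.1 q.1 by rewrite -em.
    have rpq2 : btw r.2 p.2 q.2 by rewrite -(piso_btw si rs ps qs).
    have [-> ->] : col b r.1 = col b p.1 /\ col r.1 b = col r.1 q.1.
      by apply: col_edge; rewrite // ei ej.
    have [-> ->] : col b' r.2 = col b' p.2 /\ col r.2 b' = col r.2 q.2.
      by apply: col_edge; rewrite // b'p b'q.
    by rewrite ei b'p si.
  have em2 : m.2 = q.2 by apply/eqP; rewrite -(piso_eq si ms qs) em.
  have rqp : btw r.1 q.1 p.1 by rewrite -em.
  have rqp2 : btw r.2 q.2 p.2 by rewrite -(piso_btw si rs qs ps).
  have [-> ->] : col b r.1 = col b q.1 /\ col r.1 b = col r.1 p.1.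
    by apply: col_edge; rewrite // ei ej eq_sym.
  have [-> ->] : col b' r.2 = col b' q.2 /\ col r.2 b' = col r.2 p.2.
    by apply: col_edge; rewrite // b'p b'q eq_sym.
  by rewrite ej b'q si.
apply: mcl_cons => // r t rs ts.
have [brt|brt] := eqVneq (col b r.1) (col b t.1); last first.
  exists (b, b'); rewrite ?mem_head//= /med !btw_l andbT /= /btw.
  by rewrite (negbTE brt).
(* When [b] sees [r] and [t] in one colour, replacing [b] by a point [a] of [s] beyond it does not
   change the median. *)
have [a as_ bar] : exists2 a, a \in s & col b a.1 != col b r.1.
  have [e|ne] := eqVneq (col b p.1) (col b r.1).
    by exists q => //; rewrite -e ei ej eq_sym.
  by exists p.
have [m ms /and3P[amr rmt amt]] := sm _ _ _ as_ rs ts.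
exists m; first by rewrite inE ms orbT.
have mb : m.1 != b by rewrite eq_sym sb.
have e1 : col b m.1 = col b r.1.
  apply: contraTeq rmt => n.
  have bm : b != m.1 by rewrite sb.
  have e1 := col_sep bm n.
  have e2 : col m.1 b = col m.1 t.1 by apply: col_sep => //; rewrite -brt.
  rewrite /btw -e1 -e2 eqxx /=.
  by apply: contraNneq n => ->.
have e2 : col m.1 b = col m.1 a.1.
  by apply: col_sep; [rewrite sb | rewrite e1 eq_sym].
have h c : btw a.1 m.1 c -> btw b m.1 c.
  rewrite /btw e2 => /implyP h; apply/implyP => /h ma.
  by move: e2; rewrite (eqP ma) colxx => /eqP; rewrite colE.
by rewrite /med rmt !h.
Qed.

(** Here [b] hangs at the point [n] of [s], in a component that contains no point of [s]. *)
Let extend_leaf s b n : piso s -> mcl s -> n \in s -> n.1 != b ->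
  {in s, forall p, col n.1 p.1 != col n.1 b} ->
  exists b', piso ((b, b') :: s) /\ mcl ((b, b') :: s).
Proof.
move=> si sm ns nb free.
case ei: (col n.1 b) => [i|]; last by move/eqP: ei; rewrite colE (negbTE nb).
case ek: (col b n.1) => [k|].
  2: by move/eqP: ek; rewrite colE eq_sym (negbTE nb).
(* The point [y] selects the component of colour [i] at [n.2]. Between [n.2] and [y], hence in that
   component, there is a [b'] that sees [n.2] in colour [k]; any [j] other than [k] serves as the
   colour towards [y]. *)
have [y ny] := col_surj n.2 i.
have [j jk] := col_two k.
have n2y : n.2 != y by rewrite -colE ny.
have kj : k != j by rewrite eq_sym.
have [b' [b'n b'y]] := col_kal n2y kj; exists b'.
have nb' : n.2 != b' by rewrite eq_sym -colE b'n.
have e' : col n.2 b' = Some i.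
  rewrite -ny; apply: col_sep; first by rewrite eq_sym.
  by rewrite b'n b'y; apply: contraNneq kj => -[->].
split.
  apply: piso_cons => // p ps.
  have [-> e1] := col_leaf nb (free p ps).
  have free' : col n.2 p.2 != col n.2 b' by rewrite e' -ei -si//; exact: free.
  have [-> e2] := col_leaf nb' free'.
  rewrite ek b'n; split=> //.
  have [e|pn] := eqVneq p.1 n.1.
    have e2' : p.2 = n.2 by apply/eqP; rewrite -(piso_eq si ps ns) e.
    by rewrite e e2' ei e'.
  by rewrite e1// e2 -?(piso_eq si ps ns)// si.
apply: mcl_cons => // p q ps qs.
have [m ms /and3P[nmp pmq nmq]] := sm _ _ _ ns ps qs.
exists m; first by rewrite inE ms orbT.
have [e|mn] := eqVneq m.1 n.1.
  rewrite /med pmq /btw e ![col _ b == _]eq_sym.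
  by rewrite (negbTE (free p ps)) (negbTE (free q qs)).
have [_ /(_ mn) e1] := col_leaf nb (free m ms).
have h c : btw n.1 m.1 c -> btw b m.1 c.
  rewrite /btw e1 (negbTE mn) implybF => /negbTE ->; by [].
by rewrite /med pmq !h.
Qed.

(** The point [m] is where [b] is attached to the tree spanned by [s]. If some [r] in [s] is still
    on the side of [m] containing [b], then [m] is replaced by the median [n] of [b], [r] and a
    point [a] of [s] not on that side: [r] leaves the side of [b], so the count drops. *)
Let projection s b p0 : p0 \in s -> {in s, forall p, b != p.1} ->
  {in s &, forall p q, col b p.1 = col b q.1} ->
  exists m, [/\ m != b, {in s, forall p, col m p.1 != col m b} &
    (exists2 p, p \in s & m = p.1) \/
    {in s, forall p, m != p.1} /\
      exists p q, [/\ p \in s, q \in s & col m p.1 != col m q.1]].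
Proof.
move=> p0s sb nb.
pose Q m := (exists2 p, p \in s & m = p.1) \/
    {in s, forall p, m != p.1} /\
      exists p q, [/\ p \in s, q \in s & col m p.1 != col m q.1].
suff: forall k m, m != b -> Q m ->
    count (fun p => col m p.1 == col m b) s < k ->
    exists m, [/\ m != b, {in s, forall p, col m p.1 != col m b} & Q m].
  move=> h; apply: (h _ p0.1 _ _ (leqnn _)); first by rewrite eq_sym sb.
  by left; exists p0.
elim=> // k IH m mb Qm; rewrite ltnS => le_k.
have [[r rs /eqP mrb]|no] :=
    pselect (exists2 r, r \in s & col m r.1 == col m b); last first.
  by exists m; split=> // p ps; apply/negP => e; case: no; exists p.
have [a as_ mab] : exists2 a, a \in s & col m a.1 != col m b.
  case: Qm => [[p ps e]|[_ [p [q [ps qs pq]]]]].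
    by exists p => //; rewrite -e colxx eq_sym colE.
  have [e|ne] := eqVneq (col m p.1) (col m b); last by exists p.
  by exists q => //; rewrite -e eq_sym.
have [n /and3P[bna anr bnr]] := col_med b a.1 r.1.
have nb' : n != b.
  apply/eqP => e; move: anr; rewrite e /btw (nb a r)// eqxx /=.
  by rewrite (negbTE (sb a as_)).
have nbr : col n r.1 != col n b.
  by apply: btwP => //; rewrite btwC.
have nba : col n a.1 != col n b.
  by apply: btwP => //; rewrite btwC.
have mn : m != n by apply: contraNneq nbr => <-; apply/eqP.
have mnb : col m n = col m b.
  apply: contraNeq nbr => ne; have e1 := col_sep mn ne.
  by apply/eqP; rewrite -e1; apply/esym/col_sep => //; rewrite mrb.
have nma : col n m = col n a.1.
  by apply: col_sep => //; rewrite mnb eq_sym.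
apply: (IH n) => //.
  rewrite /Q; have [?|nos] := pselect (exists2 p, p \in s & n = p.1).
    by left.
  right; split.
    by move=> p ps; apply/eqP => e; apply: nos; exists p.
  exists a, r; split=> //; apply/negP => e; apply: nos; exists a => //.
  by move/implyP: anr => /(_ e) /eqP.
apply: leq_trans le_k; apply: (@sub_in_count_lt _ _ _ _ r) => //=; last first.
  exact/eqP.
move=> p ps /eqP e; rewrite -mnb; apply/eqP/esym/col_sep.
  by rewrite eq_sym.
by rewrite nma e.
Qed.

Let extend s b : piso s -> mcl s -> s != [::] ->
  exists s', [/\ piso s', mcl s', {subset s <= s'} &
    exists2 p, p \in s' & p.1 = b].
Proof.
move=> si sm; case es: s => [//|p0 s0] _; rewrite -es.
have p0s : p0 \in s by rewrite es mem_head.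
have sub t : {subset s <= t :: s} by move=> u us; rewrite inE us orbT.
have [[p ps e]|nos] := pselect (exists2 p, p \in s & b = p.1).
  by exists s; split=> //; exists p.
have sb : {in s, forall p, b != p.1}.
  by move=> p ps; apply/eqP => e; apply: nos; exists p.
have [[p [q [ps qs pq]]]|nobtw] :=
    pselect (exists p q, [/\ p \in s, q \in s & col b p.1 != col b q.1]).
  have [b' [si' sm']] := extend_edge si sm ps qs sb pq.
  by exists ((b, b') :: s); split=> //; exists (b, b'); rewrite ?mem_head.
have [p q ps qs|m [mb free [[p ps e]|[sm_ [p [q [ps qs pq]]]]]]] :=
  projection p0s sb.
- by apply/eqP; apply: contra_notT nobtw => ne; exists p, q.
- rewrite e in mb free; have [b' [si' sm']] := extend_leaf si sm ps mb free.
  by exists ((b, b') :: s); split=> //; exists (b, b'); rewrite ?mem_head.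
(* The attaching point [m] is not in [s]. It is added before [b], since it is the median of [b] and
   two points of [s]. *)
have [m' [si1 sm1]] := extend_edge si sm ps qs sm_ pq.
have free1 : {in (m, m') :: s, forall p, col (m, m').1 p.1 != col (m, m').1 b}.
  move=> t; rewrite inE => /predU1P[->|]; last exact: free.
  by rewrite /= colxx eq_sym colE.
have [b' [si' sm']] := extend_leaf si1 sm1 (mem_head _ _) mb free1.
exists [:: (b, b'), (m, m') & s]; split=> //.
  by move=> t ts; rewrite !inE ts !orbT.
by exists (b, b'); rewrite ?mem_head.
Qed.

Let swap (p : V * V) := (p.2, p.1).

Let swap_piso s : piso s -> piso (map swap s).
Proof. by move=> si _ _ /mapP[p ps ->] /mapP[q qs ->] /=; rewrite si. Qed.

Let swap_mcl s : piso s -> mcl s -> mcl (map swap s).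
Proof.
move=> si sm _ _ _ /mapP[p ps ->] /mapP[q qs ->] /mapP[r rs ->].
have [m ms /and3P[pmq qmr pmr]] := sm _ _ _ ps qs rs.
exists (swap m); first exact: map_f.
by rewrite /med /= -(piso_btw si ps ms qs) -(piso_btw si qs ms rs)
  -(piso_btw si ps ms rs); apply/and3P.
Qed.

Let good s := [/\ piso s, mcl s & s != [::]].

Let extend_both s b : good s -> exists s', [/\ good s', {subset s <= s'},
  exists2 p, p \in s' & p.1 = b & exists2 p, p \in s' & p.2 = b].
Proof.
move=> [si sm s0].
have s0_ : has predT s by case: s s0 {si sm}.
have [s1 [si1 sm1 ss1 [p ps1 pb]]] := extend b si sm s0.
have s1t : has predT s1.
  by have /hasP[x /ss1 xs _] := s0_; apply/hasP; exists x.
have s10 : map swap s1 != [::] by case: (s1) s1t.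
have [s2 [si2 sm2 ss2 [q qs2 qb]]] :=
  extend b (swap_piso si1) (swap_mcl si1 sm1) s10.
have inc t : t \in s1 -> t \in map swap s2.
  by move=> ts; apply/mapP; exists (swap t); [apply/ss2/map_f | case: (t)].
exists (map swap s2); split.
- split; [exact: swap_piso | exact: swap_mcl |].
  by have := inc p ps1; case: (s2).
- by move=> t /ss1; exact: inc.
- by exists p => //; exact: inc.
- by exists (swap q) => //; exact: map_f.
Qed.

(** The two equations make [[:: (x, x); (a, a')]] a partial isomorphism, and two points are always
    closed under medians. Stage [k] puts [e k] into both domain and range. *)
Lemma col_automorphism (e : nat -> V) (x a a' : V) :
  (forall v, exists k, e k = v) ->
  col x a = col x a' -> col a x = col a' x ->
  exists f g : V -> V, [/\ cancel f g, cancel g f, f x = x, f a = a' &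
    forall u v, col (f u) (f v) = col u v].
Proof.
move=> e_surj xa ax.
pose s0 := [:: (x, x); (a, a')].
have good0 : good s0.
  split=> //.
    by move=> p q; rewrite !inE => /orP[]/eqP-> /orP[]/eqP->; rewrite /= ?colxx.
  have h p q : p \in s0 -> q \in s0 ->
      exists2 m, m \in s0 & med m.1 p.1 p.1 q.1.
    by move=> ps qs; exists p; rewrite // /med !btw_l.
  move=> p q r; rewrite !inE => /orP[]/eqP-> /orP[]/eqP-> /orP[]/eqP->;
    (by exists (x, x); rewrite ?inE ?eqxx ?orbT ///med ?btw_l ?btw_r) ||
    (by exists (a, a'); rewrite ?inE ?eqxx ?orbT ///med ?btw_l ?btw_r).
have step (st : {s | good s}) (k : nat) : exists st' : {s | good s},
    [/\ {subset proj1_sig st <= proj1_sig st'},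
    exists2 p, p \in proj1_sig st' & p.1 = e k &
    exists2 p, p \in proj1_sig st' & p.2 = e k].
  case: st => s gs /=; have [s' [gs' ss h1 h2]] := extend_both (e k) gs.
  by exists (exist _ s' gs').
pose next st k := proj1_sig (cid (step st k)).
pose S := fix S k := if k is k'.+1 then next (S k') k' else exist good s0 good0.
have SS k : {subset proj1_sig (S k) <= proj1_sig (S k.+1)}.
  by rewrite /= /next; case: cid => ? [].
have mono k l : k <= l -> {subset proj1_sig (S k) <= proj1_sig (S l)}.
  elim: l => [|l IH]; first by rewrite leqn0 => /eqP ->.
  by rewrite leq_eqVlt => /predU1P[->//|/IH h] t /h /SS.
pose P (t : V * V) := exists k, t \in proj1_sig (S k).
have Piso p q : P p -> P q -> col p.1 q.1 = col p.2 q.2.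
  move=> [k pk] [l ql]; have [si _ _] := proj2_sig (S (maxn k l)).
  apply: si; first by apply: mono pk; exact: leq_maxl.
  by apply: mono ql; exact: leq_maxr.
have Pdom v : exists w, P (v, w).
  have [k <-] := e_surj v.
  have : exists2 p, p \in proj1_sig (S k.+1) & p.1 = e k.
    by rewrite /= /next; case: cid => ? [].
  by move=> [[p1 p2] ps /= <-]; exists p2, k.+1.
have Pran v : exists w, P (w, v).
  have [k <-] := e_surj v.
  have : exists2 p, p \in proj1_sig (S k.+1) & p.2 = e k.
    by rewrite /= /next; case: cid => ? [].
  by move=> [[p1 p2] ps /= <-]; exists p1, k.+1.
have [f fP] := choice Pdom; have [g gP] := choice Pran.
have Pfun p q : P p -> P q -> (p.1 == q.1) = (p.2 == q.2).
  by move=> pP qP; rewrite -!colE (Piso p q).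
have P0 t : t \in s0 -> P t by exists 0.
exists f, g; split.
- by move=> v; apply/eqP; rewrite (Pfun _ _ (gP (f v)) (fP v)).
- by move=> v; apply/eqP; rewrite -(Pfun _ _ (fP (g v)) (gP v)).
- by apply/eqP; rewrite -(Pfun _ _ (fP x) (P0 (x, x) _))// !inE eqxx.
- by apply/eqP; rewrite -(Pfun _ _ (fP a) (P0 (a, a') _))// !inE eqxx orbT.
- by move=> u v; rewrite -(Piso _ _ (fP u) (fP v)).
Qed.

End BackAndForth.

(** * Cutting a locally connected continuum at a point *)

Lemma filter_seq_forall (T : Type) (I : eqType) (F : set_system T)
    {FF : Filter F} (s : seq I) (f : I -> set T) :
  (forall i, i \in s -> F (f i)) -> F [set z | forall i, i \in s -> f i z].
Proof.
elim: s => [|i s IH] sF.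
  by apply: (@filterS T F FF setT) => [z _ i|]; [rewrite in_nil|exact: filterT].
have Fs : F [set z | forall i, i \in s -> f i z].
  by apply: IH => j js; apply: sF; rewrite inE js orbT.
apply: filterS (filterI (sF i (mem_head _ _)) Fs) => z [iz sz] j.
by rewrite inE => /predU1P[->|/sz].
Qed.

Lemma compact_fip (T : topologicalType) (I : eqType) (D : set I)
    (f : I -> set T) : compact [set: T] ->
  (forall i, D i -> closed (f i)) ->
  (forall s : seq I, (forall i, i \in s -> D i) ->
    exists z, forall i, i \in s -> f i z) ->
  exists z, forall i, D i -> f i z.
Proof.
move=> Tc fc fip.
pose F : set_system T := filter_from [set s : seq I | forall i, i \in s -> D i]
  (fun s => [set z | forall i, i \in s -> f i z]).
have FF : ProperFilter F.
  apply: filter_from_proper; last by move=> s /fip[z zP]; exists z.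
  apply: filter_from_filter; first by exists [::] => i; rewrite in_nil.
  move=> s t sD tD; exists (s ++ t).
    by move=> i; rewrite mem_cat => /orP[/sD|/tD].
  by move=> z zP; split=> i ist; apply: zP; rewrite mem_cat ist ?orbT.
have [q [_ clq]] := Tc F FF filterT.
exists q => i Di; apply: fc => // U nU; apply: clq nU.
exists [:: i]; first by move=> j; rewrite inE => /eqP ->.
by move=> z; apply; rewrite inE.
Qed.

(** Empty when [y = x], so that [side x y z] includes that [y] and [z] differ from [x]. *)
Definition side (X : topologicalType) (x y : X) : set X :=
  connected_component (~` [set x]) y.

Section Cut.
Variable X : topologicalType.
Hypothesis X_hausdorff : hausdorff_space X.
Hypothesis X_compact : compact [set: X].
Hypothesis X_connected : connected [set: X].
Hypothesis X_loc_connected : locally_connected X.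
Implicit Types (p q u v w x y z : X).

Lemma side_max x y (A : set X) : connected A -> A y -> ~ A x -> A `<=` side x y.
Proof.
move=> cA Ay nAx; apply: connected_component_max => // z Az /= zx.
by apply: nAx; rewrite -zx.
Qed.

Lemma side_neq x y z : side x y z -> z <> x.
Proof. exact: connected_component_sub. Qed.

Lemma side_refl x y : y <> x -> side x y y.
Proof. by move=> yx; exact: connected_component_refl. Qed.

Lemma side_sym x y z : side x y z -> side x z y.
Proof. exact: connected_component_sym. Qed.

Lemma side_trans x y z t : side x y z -> side x z t -> side x y t.
Proof. exact: connected_component_trans. Qed.

Lemma side_neql x y z : side x y z -> y <> x.
Proof. by move/side_sym/side_neq. Qed.

Lemma side_eq x y z : side x y z -> side x y = side x z.
Proof. exact: same_connected_component. Qed.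

Lemma side_connected x y : connected (side x y).
Proof. exact: component_connected. Qed.

Lemma nbhs_setC1 x y : y <> x -> nbhs y (~` [set x]).
Proof.
move=> yx; apply: open_nbhs_nbhs; split=> //; rewrite openC.
exact/accessible_closed_set1/hausdorff_accessible.
Qed.

Lemma side_open x y : open (side x y).
Proof.
rewrite openE => z xyz.
have [V [oV Vz cV Vx]] := X_loc_connected (nbhs_setC1 (side_neq xyz)).
apply: (@filterS _ _ _ V); last exact: open_nbhs_nbhs.
move=> t Vt; apply: (side_trans xyz).
by apply: (side_max cV Vz _ Vt) => /Vx; exact.
Qed.

Lemma side_nbhs x y z : side x y z -> nbhs z (side x y).
Proof. by move=> h; apply: open_nbhs_nbhs; split => //; exact: side_open. Qed.

Lemma closure_side x y : closure (side x y) `<=` side x y `|` [set x].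
Proof.
move=> z cz; have [->|/eqP zx] := eqVneq z x; [by right | left].
have [t [xyt xzt]] := cz _ (side_nbhs (side_refl zx)).
exact: side_trans xyt (side_sym xzt).
Qed.

(** Otherwise the component would be both open and closed in the connected space [X]. *)
Lemma side_closure x y : y <> x -> closure (side x y) x.
Proof.
move=> yx; apply: contrapT => ncx.
have := @side_refl x y yx.
have e : side x y = closure (side x y).
  apply/seteqP; split; first exact: subset_closure.
  move=> z cz; have [//|zx] := closure_side cz.
  by case: ncx; move: cz; rewrite zx.
suff eT : side x y = setT.
  by case: ncx; apply: subset_closure; rewrite eT.
apply: X_connected.
- by exists y; exact: side_refl.
- by exists (side x y); [exact: side_open | rewrite setTI].
- exists (closure (side x y)); first exact: closed_closure.
  by rewrite setTI.
Qed.

Lemma side_bdry_connected x y : y <> x -> connected (side x y `|` [set x]).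
Proof.
move=> yx; rewrite (_ : _ `|` _ = closure (side x y)).
  exact/connected_closure/side_connected.
apply/seteqP; split; last exact: closure_side.
by move=> z [|->]; [exact: subset_closure | exact: side_closure].
Qed.

(** The component of [w] at [u], with [u] added, is connected and avoids [v]. This is the geometric
    source of [col_sep]. *)
Lemma side_flip u v w : v <> u -> w <> u -> ~ side u w v -> side v u w.
Proof.
move=> vu wu nv.
apply: (@side_max v u _ (side_bdry_connected wu)); first by right.
- by move=> [].
- by left; exact: side_refl.
Qed.

Lemma side_open_meet x y (U : set X) :
  y <> x -> nbhs x U -> side x y `&` U !=set0.
Proof. by move=> /side_closure; apply. Qed.

Lemma side_sub u v p q : ~ side u p v -> side v q p -> side u p `<=` side v q.
Proof.
move=> upv vqp z upz; apply: side_trans vqp _.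
have upp := side_refl (side_neql upz).
exact: side_max (@side_connected u p) upp upv _ upz.
Qed.

(** If [w' <> w], at most one of the three points is on the side of [w] containing [w']. Seen from
    [w'], the other two are on the side of [w], hence on a common side. *)
Lemma center_unique w w' a b c :
  ~ side w a b -> ~ side w b c -> ~ side w a c ->
  ~ side w' a b -> ~ side w' b c -> ~ side w' a c ->
  a <> w -> b <> w -> c <> w -> w' = w.
Proof.
move=> ab bc ac ab' bc' ac' aw bw cw; apply: contrapT => ww.
have h p q : p <> w -> q <> w -> ~ side w p w' -> ~ side w q w' -> side w' p q.
  move=> pw qw np nq.
  exact: side_trans (side_sym (side_flip ww pw np)) (side_flip ww qw nq).
have [aw'|naw'] := pselect (side w a w').
  apply: bc'; apply: h => // h'.
  - by apply: ab; apply: side_trans aw' (side_sym h').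
  - by apply: ac; apply: side_trans aw' (side_sym h').
have [bw'|nbw'] := pselect (side w b w'); last by apply: ab'; exact: h.
apply: ac'; apply: h => // h'.
by apply: bc; apply: side_trans bw' (side_sym h').
Qed.

(** * Half-spaces cut off at the points of a separating set [B] *)

Section Separators.
Variable B : set X.
Hypothesis B_sep : forall p q, p <> q ->
  exists w, [/\ B w, p <> w, q <> w & ~ side w p q].

(** Each point [q] of a closed, hence compact, complement is separated from [p] by some [w q].
    Finitely many of the sides containing such [q] cover it, and the sides of [p] at these cut
    points have their intersection in [U]. *)
Lemma side_basis p (U : set X) : nbhs p U -> exists s : seq X,
  [/\ (forall x, x \in s -> B x /\ p <> x) &
    [set z | forall x, x \in s -> side x p z] `<=` U].
Proof.
rewrite nbhsE => -[U' [oU' U'p] U'U].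
have /choice[w wP] q : exists w, q <> p ->
    [/\ B w, p <> w, q <> w & ~ side w p q].
  have [->|/eqP qp] := eqVneq q p; first by exists p.
  by have [w ?] := B_sep (not_eq_sym qp); exists w.
have U'q q : (~` U') q -> q <> p by move=> nq e; apply: nq; rewrite e.
apply: contrapT => no.
have [q qP] : exists q, forall z, (~` U') z ->
    (~` U' `&` ~` side (w z) z) q.
  apply: compact_fip => // [z _|s sU'].
    by apply: closedI; rewrite closedC//; exact: side_open.
  apply: contrapT => nos; apply: no; exists (map w s); split.
    by move=> _ /mapP[q qs ->]; have [] := wP q (U'q q (sU' q qs)).
  move=> z zP; apply: U'U; apply: contrapT => nU'z; apply: nos.
  exists z => q qs; split=> // wqz.
  have [_ _ _] := wP q (U'q q (sU' q qs)); apply.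
  by apply: side_trans (side_sym wqz); apply: zP; exact: map_f.
have [z0 nU'z0] : exists z0, (~` U') z0.
  apply: contrapT => noz; apply: no; exists [::]; split=> // z _.
  by apply: U'U; apply: contrapT => nz; apply: noz; exists z.
have [nU'q _] := qP z0 nU'z0; have [_ nwq] := qP q nU'q.
by have [_ _ ? _] := wP q (U'q q nU'q); apply/nwq/side_refl.
Qed.

Variables (x0 x1 : X) (x01 : x0 <> x1).

(** A connected space with two points has no isolated point, so a connected neighbourhood [V] of [p]
    contains another point [q], and whatever separates [p] from [q] lies in [V]. *)
Lemma B_dense p (U : set X) : nbhs p U -> exists2 b, B b & U b.
Proof.
move=> /X_loc_connected[V [oV Vp cV VU]].
have [q Vq qp] : exists2 q, V q & q <> p.
  apply: contrapT => no.
  have eV : V = [set p].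
    apply/seteqP; split=> [q Vq|_ -> //]; apply: contrapT => qp.
    by apply: no; exists q.
  suff eT : [set p] = setT.
    apply: x01; have := I : setT x0; have := I : setT x1.
    by rewrite -eT => -> ->.
  apply: X_connected.
  - by exists p.
  - by exists V; rewrite // setTI.
  - exists [set p]; rewrite ?setTI//.
    exact/accessible_closed_set1/hausdorff_accessible.
have [w [Bw _ _ npq]] := B_sep (not_eq_sym qp).
exists w => //; apply: VU; apply: contrapT => nVw.
by apply: npq; exact: (side_max cV Vp nVw Vq).
Qed.

(* Half-spaces not containing [q] are pairwise nested or disjoint, so lying in
   a common one is an equivalence relation with open classes. *)
Lemma fork p p' q : side q p p' ->
  exists w, [/\ B w, q <> w, side w p p' & ~ side w p q].
Proof.
move=> qpp'.
pose A := [set b | exists w, [/\ B w, q <> w, side w p b & ~ side w p q]].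
suff : side q p `&` A = side q p by move=> e; move: qpp'; rewrite -e => -[].
apply: side_connected.
- exists p; split; first exact: side_refl (side_neql qpp').
  have [w [Bw pw qw npq]] := B_sep (side_neql qpp').
  by exists w; split=> //; exact: side_refl.
- exists A => //; rewrite openE => b [w [Bw qw wpb npq]].
  apply: filterS (side_nbhs wpb) => c wpc; by exists w.
exists (A `|` [set q]); last first.
  apply/seteqP; split=> [b [? ?]|b [h [//|e]]]; first by split=> //; left.
  by have := side_neq h; rewrite e.
rewrite -[A `|` _]setCK closedC openE => b /not_orP[nAb bq].
have [w [Bw bw qw nbq]] := B_sep bq.
apply: filterS (side_nbhs (side_refl bw)) => c wbc.
move=> [[w1 [Bw1 qw1 w1pc npq]]|cq]; last first.
  by apply: nbq; rewrite -cq.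
apply: nAb; have [e|/eqP ww1] := eqVneq w1 w.
  exists w; split=> //; last by rewrite -e.
  by apply: side_trans (side_sym wbc); rewrite -e.
(* The sides of [w] and [w1] around [c] meet. If one misses the cut point of the other, it is
   contained in the other, and [w] or [w1] witnesses [A b]. If neither does, then [w] sees [q] in
   the direction of [w1], which is that of [b], against the choice of [w]. *)
have [hw|hw] := pselect (side w1 p w); last first.
  have wpb : side w p b.
    apply: side_sym; rewrite (side_eq w1pc) in hw.
    by apply: (side_sub hw wbc); exact: side_sym.
  exists w; split=> // wpq; apply: nbq; exact: side_trans (side_sym wpb) wpq.
have [hw1|hw1] := pselect (side w b w1); last first.
  exists w1; split=> //; rewrite (side_eq wbc) in hw1.
  by apply: (side_sub hw1 w1pc); exact: side_sym.
case: nbq; apply: side_trans hw1 _.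
apply: side_flip => //; first exact/not_eq_sym.
by move=> w1qw; apply: npq; apply: side_trans hw (side_sym w1qw).
Qed.

(* Without a median, every [w] has a component [M w] containing two of the three
   points; the closures of these have the finite intersection property, and
   [fork] applied at a common point gives a contradiction. *)
Lemma median a b c : exists q,
  [/\ q = a \/ q = b \/ ~ side q a b, q = b \/ q = c \/ ~ side q b c &
      q = a \/ q = c \/ ~ side q a c].
Proof.
apply: contrapT => no.
have no' q : side q a b \/ side q b c \/ side q a c.
  apply: contrapT => /not_orP[h /not_orP[h1 h2]]; apply: no; exists q.
  by split; right; right.
have /choice[m mP] w : exists y,
    [\/ side w y a /\ side w y b, side w y b /\ side w y c
      | side w y a /\ side w y c].
  have r y z : side w y z -> side w y y by move/side_neql/side_refl.
  case: (no' w) => [h|[h|h]].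
  - by exists a; apply: Or31; split=> //; exact: r h.
  - by exists b; apply: Or32; split=> //; exact: r h.
  - by exists a; apply: Or33; split=> //; exact: r h.
pose M w := side w (m w).
have Mmeet w v : exists z, M w z /\ M v z.
  by have [[]|[]|[]] := mP w; have [[]|[]|[]] := mP v;
   move=> ? ? ? ?; (by exists a) || (by exists b) || (by exists c).
have fip (s : seq X) : exists z, forall w, w \in s -> M w z.
  elim: s => [|w s [z zP]]; first by exists a.
  have [Mwz|nMwz] := pselect (M w z).
    by exists z => v; rewrite inE => /predU1P[->|/zP].
  (* If [M v] missed [w], then, as it meets [M w], it would be contained in [M w] and [z] with it.
     So [w] lies in all these open [M v], and points of [M w] close to [w] lie in all of them. *)
  have Mw v : v \in s -> M v w.
    move=> vs; apply: contrapT => nMvw; apply: nMwz.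
    have [t [Mwt Mvt]] := Mmeet w v.
    rewrite /M (side_eq Mvt) in nMvw.
    by apply: (side_sub nMvw Mwt); rewrite -(side_eq Mvt); exact: zP.
  have mw : m w <> w by have [[/side_neql]|[/side_neql]|[/side_neql]] := mP w.
  have [t [Mwt st]] := side_open_meet mw
    (filter_seq_forall (fun v vs => side_nbhs (Mw v vs))).
  by exists t => v; rewrite inE => /predU1P[->|/st].
have [q qP] : \bigcap_(w in [set: X]) closure (M w) !=set0.
  apply: compact_fip => // [w _|s _]; first exact: closed_closure.
  by have [z zP] := fip s; exists z => w ws; apply: subset_closure; exact: zP.
have contra y z : side q y z ->
    (forall w, side w y z -> M w = side w y) -> False.
  move=> qyz hM; have [w [Bw qw wyz nyq]] := fork qyz.
  have := qP w I; rewrite (hM w wyz) => /closure_side[//|/=].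
  exact: qw.
have Meq w y t : M w y -> M w = side w y by exact: side_eq.
case: (no' q) => [h|[h|h]]; apply: (contra _ _ h) => w wyz;
  have [[h1 h2]|[h1 h2]|[h1 h2]] := mP w; apply: side_eq => //;
  by apply: side_trans (side_sym wyz).
Qed.

Hypothesis B_3 : forall w z, B w -> exists y y',
  [/\ y <> w, y' <> w, ~ side w z y, ~ side w z y' & ~ side w y y'].

(** With [U'] a finite intersection of half-spaces, a half-space cut off at a point of [U'] lies in
    [U'] unless it contains one of the cut points [x] in [s]. In that case some [v] of [B] in it and
    in [U'] has a side avoiding both [w] and [x], and this smaller half-space contains fewer cut
    points. *)
Lemma half_space_sub p (U : set X) : nbhs p U ->
  exists w y, [/\ B w, y <> w & side w y `<=` U].
Proof.
move=> /side_basis[s [sB sU]].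
pose U' := [set z | forall x, x \in s -> side x p z].
have nU' z : U' z -> nbhs z U'.
  by move=> zU'; apply: filter_seq_forall => x xs; apply: side_nbhs; exact: zU'.
suff h k w y : B w -> U' w -> y <> w ->
    count (fun x => `[< side w y x >]) s < k ->
    exists w y, [/\ B w, y <> w & side w y `<=` U].
  have U'p : U' p by move=> x /sB[_ px]; exact: side_refl.
  have [w Bw U'w] := B_dense (nU' p U'p).
  have [y yw] : exists y, y <> w.
    have [<-|/eqP ne] := eqVneq x0 w; last by exists x0.
    by exists x1; exact/not_eq_sym.
  exact: (h _ w y Bw U'w yw (leqnn _)).
elim: k w y => // k IH w y Bw U'w yw; rewrite ltnS => le_k.
have [[x xs wyx]|nox] := pselect (exists2 x, x \in s & side w y x); last first.
  exists w, y; split=> // t wyt; apply: sU => x xs.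
  apply: side_trans (U'w x xs) _; apply: side_flip.
  - by move=> xw; apply: (side_neq (U'w x xs)).
  - exact: side_neq wyt.
  - by move=> wtx; apply: nox; exists x => //; exact: side_trans wyt wtx.
have [t [wyt U't]] := side_open_meet yw (nU' w U'w).
have [v Bv [wyv U'v]] := B_dense (filterI (side_nbhs wyt) (nU' t U't)).
have vw := side_neq wyv.
have [y1 [y2 [y1v y2v n1 n2 n12]]] := B_3 w Bv.
have [y' [y'v nwy' nx]] :
    exists y', [/\ y' <> v, ~ side v w y' & ~ side v y' x].
  have [h|h] := pselect (side v y1 x); last by exists y1.
  by exists y2; split=> // h2; apply: n12; exact: side_trans h (side_sym h2).
apply: (IH v y' Bv U'v y'v); apply: leq_trans le_k.
apply: (@sub_in_count_lt _ _ _ _ x) => //; last 2 first.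
- exact/asboolP.
- by apply/negP => /asboolP.
move=> z _ /asboolP vy'z; apply/asboolP; apply: side_trans wyv _.
apply: side_flip.
- exact/not_eq_sym.
- exact: side_neq vy'z.
- by move=> vzw; apply: nwy'; apply: side_sym; exact: side_trans vy'z vzw.
Qed.

Section Extension.
Variables f g : X -> X.
Hypothesis fB : forall x, B x -> B (f x).
Hypothesis gB : forall x, B x -> B (g x).
Hypothesis fK : forall x, B x -> g (f x) = x.
Hypothesis gK : forall x, B x -> f (g x) = x.
Hypothesis f_side : forall x y z, B x -> B y -> B z ->
  side x y z -> side (f x) (f y) (f z).
Hypothesis g_side : forall x y z, B x -> B y -> B z ->
  side x y z -> side (g x) (g y) (g z).

(** The half-spaces around [p] have images with the finite intersection property, by density of [B],
    and compactness gives the value at [p] as a common point of their closures. *)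
Lemma extend_continuous : exists h : X -> X,
  continuous h /\ forall x, B x -> h x = f x.
Proof.
have nf x y : B x -> B y -> x <> y -> f x <> f y.
  by move=> Bx By xy e; apply: xy; rewrite -(fK Bx) e fK.
have nf_side x y z : B x -> B y -> B z ->
    ~ side x y z -> ~ side (f x) (f y) (f z).
  move=> Bx By Bz nxyz h; apply: nxyz; rewrite -(fK Bx) -(fK By) -(fK Bz).
  by apply: g_side => //; exact: fB.
have /choice[h hP] p : exists q, forall x y, B x -> B y -> side x p y ->
    side (f x) (f y) q.
  have [q qP] :
      \bigcap_(t in [set t : X * X | [/\ B t.1, B t.2 & side t.1 p t.2]])
        closure (side (f t.1) (f t.2)) !=set0.
    apply: compact_fip => // [t _|s sD]; first exact: closed_closure.
    have [z Bz zP] : exists2 z, B z &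
        forall t, t \in s -> side t.1 p z.
      apply: (@B_dense p); apply: filter_seq_forall => t /sD[_ _].
      by move=> /side_neql h; apply: side_nbhs; exact: side_refl.
    exists (f z) => t /= ts; apply: subset_closure.
    have [B1 B2 h] := sD t ts.
    by apply: f_side => //; apply: side_trans (side_sym h) _; exact: zP.
  exists q => x y Bx By xpy.
  have [//|/= e] := closure_side (qP (x, y) (And3 Bx By xpy)).
  (* It remains to exclude that [q] is the cut point [f x]: a point [w] separating [x] from [p]
     gives a half-space around [p] whose image has a closure missing [f x]. *)
  have [w [Bw pw xw npx]] := B_sep (side_neql xpy).
  have [z Bz wpz] := B_dense (side_nbhs (side_refl pw)).
  have [/= h|/= h] := closure_side (qP (w, z) (And3 Bw Bz wpz)).
    case: npx; apply: side_trans wpz _; apply: contrapT.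
    by move=> /(nf_side _ _ _ Bw Bz Bx); apply; rewrite -e.
  by case: (nf _ _ Bx Bw xw); rewrite -e h.
exists h.
have hf x : B x -> h x = f x.
  move=> Bx; apply: contrapT => ne.
  have [w [Bw hw fw nw]] := B_sep ne.
  have gwx : x <> g w by move=> e; apply: fw; rewrite e gK.
  have [y By gwxy] := B_dense (side_nbhs (side_refl gwx)).
  apply: nw; rewrite -(gK Bw).
  apply: side_trans (side_sym (hP _ _ _ (gB Bw) By gwxy)) _.
  by apply: f_side => //; [exact: gB|exact: side_sym].
split=> // p U /side_basis[s [sB sU]].
suff : nbhs p (h @^-1` U) by [].
apply: (@filterS _ _ _ [set z | forall x, x \in s -> side (g x) p z]).
  move=> z zP; apply: sU => x xs; have [Bx _] := sB x xs.
  have [y By py] := B_dense (side_nbhs (zP x xs)).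
  rewrite -(gK Bx); apply: side_trans (side_sym (hP _ _ _ (gB Bx) By py)) _.
  apply: hP => //; first exact: gB.
  exact: side_trans (side_sym (zP x xs)) py.
apply: filter_seq_forall => x xs; have [Bx px] := sB x xs.
apply: side_nbhs; apply: side_refl => e; apply: px.
by rewrite e hf ?gK//; exact: gB.
Qed.

End Extension.

Lemma extend_homeomorphism (f g : X -> X) :
  (forall x, B x -> B (f x)) -> (forall x, B x -> B (g x)) ->
  (forall x, B x -> g (f x) = x) -> (forall x, B x -> f (g x) = x) ->
  (forall x y z, B x -> B y -> B z -> side x y z -> side (f x) (f y) (f z)) ->
  (forall x y z, B x -> B y -> B z -> side x y z -> side (g x) (g y) (g z)) ->
  exists2 h : bijection X X, homeomorphism h & forall x, B x -> h x = f x.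
Proof.
move=> fB gB fK gK fc gc.
have [h [hc hf]] := extend_continuous fB gB fK gK fc gc.
have [k [kc kg]] := extend_continuous gB fB gK fK gc fc.
have id_of (u : X -> X) : continuous u -> (forall x, B x -> u x = x) ->
    forall x, u x = x.
  move=> uc uB x; apply: X_hausdorff => U V nU nV.
  have nuU : nbhs x (u @^-1` U) by exact: uc.
  have [b Bb [Ub Vb]] := B_dense (filterI nuU nV).
  by exists b; split=> //; rewrite -(uB b Bb).
have hk : cancel h k.
  apply: id_of.
    by move=> x; apply: continuous_comp; [exact: hc|exact: kc].
  by move=> x Bx; rewrite hf// kg ?fK//; exact: fB.
have kh : cancel k h.
  apply: id_of.
    by move=> x; apply: continuous_comp; [exact: kc|exact: hc].
  by move=> x Bx; rewrite kg// hf ?gK//; exact: gB.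
by exists (Bijection hk kh).
Qed.

(** Three points of [D] on three different sides of [w] determine [w], by [center_unique]. *)
Lemma B_countable : (exists2 D : set X, countable D & dense D) -> countable B.
Proof.
move=> [D cD dD].
have pt w y : y <> w -> exists2 d, D d & side w y d.
  move=> yw; have [|d [? ?]] := dD (side w y) _ (@side_open w y).
    by exists y; exact: side_refl.
  by exists d.
have /choice[t tP] w : exists t : X * X * X, B w ->
   [/\ [/\ D t.1.1, D t.1.2 & D t.2], [/\ t.1.1 <> w, t.1.2 <> w & t.2 <> w] &
    [/\ ~ side w t.1.1 t.1.2, ~ side w t.1.2 t.2 & ~ side w t.1.1 t.2]].
  have [Bw|nBw] := pselect (B w); last by exists (w, w, w).
  have [z zw] : exists z, z <> w.
    have [<-|/eqP ne] := eqVneq x0 w; last by exists x0.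
    by exists x1; exact/not_eq_sym.
  have [y [y' [yw y'w zy zy' yy']]] := B_3 z Bw.
  have [a Da za] := pt _ _ zw; have [b Db yb] := pt _ _ yw.
  have [c Dc yc] := pt _ _ y'w.
  exists (a, b, c) => _ /=; split.
  - by [].
  - by split; [exact: side_neq za | exact: side_neq yb | exact: side_neq yc].
  split=> h.
  - by apply: zy; apply: side_trans (side_trans za h) (side_sym yb).
  - by apply: yy'; apply: side_trans (side_trans yb h) (side_sym yc).
  - by apply: zy'; apply: side_trans (side_trans za h) (side_sym yc).
have inj_t : {in B &, injective t}.
  move=> w w' /set_mem Bw /set_mem Bw' e.
  have [_ [h1 h2 h3] [h4 h5 h6]] := tP w Bw.
  have [_ _ [h4' h5' h6']] := tP w' Bw'.
  by apply/esym/(@center_unique w w' (t w).1.1 (t w).1.2 (t w).2); rewrite // e.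
have /countable_injP[r r_inj] := countableX (countableX cD cD) cD.
have tD w : B w -> t w \in D `*` D `*` D.
  by move=> /tP[[? ? ?] _ _]; rewrite inE.
apply/countable_injP; exists (r \o t) => w w' Bw Bw' /= e.
apply: inj_t => //.
by apply: r_inj e; apply: tD; [exact: set_mem Bw | exact: set_mem Bw'].
Qed.

End Separators.
End Cut.

(** * Compact metrizable spaces and arcs *)

Section Metrizable.
Local Open Scope ring_scope.

Lemma inv_succ_lt (R : realType) (e : R) : 0 < e -> exists k, k.+1%:R^-1 < e.
Proof.
move=> e0; exists (Num.truncn e^-1).
by rewrite invf_plt ?posrE//; exact: truncnS_gt.
Qed.

Variables (R : realType) (X : topologicalType).

Lemma homeomorphic_hausdorff (Y : topologicalType) :
  homeomorphic X Y -> hausdorff_space Y -> hausdorff_space X.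
Proof.
move=> [h [hc _]] hY p q pq; apply: (can_inj (bij_funK h)); apply: hY.
by move=> A B /hc hA /hc hB; have [x [? ?]] := pq _ _ hA hB; exists (h x).
Qed.

Lemma metrizable_hausdorff : metrizable R X -> hausdorff_space X.
Proof.
by move=> [M /homeomorphic_hausdorff]; apply; exact: metric_hausdorff.
Qed.

Lemma compact_metrizable_separable :
  compact [set: X] -> metrizable R X -> separable X.
Proof.
move=> Xc [M [h [hc hc']]].
have net k : exists s : seq X, forall x, exists2 y, y \in s &
    ball (h y) k.+1%:R^-1 (h x).
  apply: contrapT => no.
  have k0 : 0 < k.+1%:R^-1 :> R by [].
  have [q qP] : exists q, forall y, setT y ->
      (~` (h @^-1` (ball (h y) k.+1%:R^-1)°)) q.
    apply: compact_fip => // [y _|s _].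
      rewrite closedC; apply: open_comp; last exact: open_interior.
      by move=> x _; exact: hc.
    apply: contrapT => nos; apply: no; exists s => x.
    apply: contrapT => nox; apply: nos; exists x => y ys hy.
    by apply: nox; exists y => //; exact: interior_subset hy.
  apply: (qP q I); exact: nbhsx_ballx.
have [s sP] := choice net.
exists (\bigcup_k [set x | x \in s k]).
  by apply: bigcup_countable => // k _; exact/finite_set_countable/finite_seq.
move=> U [x Ux] oU.
have : nbhs (h x) (bij_inv h @^-1` U).
  by apply: hc'; rewrite /= bij_funK; exact: open_nbhs_nbhs.
rewrite -nbhs_ballE => -[e /= e0 eU].
have [k ke] := inv_succ_lt e0.
have [y ys yx] := sP k x.
exists y; split; last by exists k.
rewrite -[y](bij_funK h); apply: eU; apply: ball_sym.
by apply: le_ball yx; exact: ltW.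
Qed.

End Metrizable.

(** * Arcs as injective paths, and separation along them *)

Section Arcs.
Local Open Scope ring_scope.
Variables (R : realType) (X : topologicalType).

(** Clamping to the unit interval extends the parametrization to the whole line, where continuity
    and connectedness of segments apply directly. *)
Lemma arc_path (x y : X) (A : set X) : is_arc R x y A -> exists f : R -> X,
  [/\ continuous f, f 0 = x, f 1 = y,
      {in `[0, 1] &, injective f} & A = f @` `[0, 1]].
Proof.
move=> [h [hc _] hxy].
have clampP (t : R) : Num.max 0 (Num.min t 1) \in @unit_interval R.
  rewrite inE /unit_interval /= in_itv /= le_max lexx /=.
  by rewrite ge_max ler01 ge_min lexx orbT.
pose clamp (t : R) : @unit_interval R :=
  exist (fun t => t \in @unit_interval R) _ (clampP t).
have clampE (t : @unit_interval R) : clamp (val t) = t.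
  apply: val_inj => /=; have := valP t.
  rewrite inE /unit_interval /= in_itv /= => /andP[t0 t1].
  by rewrite (min_idPl t1) (max_idPr t0).
have clamp_c : continuous clamp.
  apply: continuous_comp_initial => t /=.
  apply: (@continuous_max R R (fun=> 0) (fun t => Num.min t 1)).
    exact: cvg_cst.
  apply: (@continuous_min R R id (fun=> 1)); [exact: cvg_id|exact: cvg_cst].
exists (fun t => val (h (clamp t))); split.
- move=> t; apply: (@continuous_comp _ _ _ (h \o clamp) val).
    by apply: continuous_comp; [exact: clamp_c | exact: hc].
  exact: initial_continuous.
- have [+ _] := hxy (clamp 0); apply => /=.
  by rewrite (min_idPl ler01) maxxx.
- have [_ +] := hxy (clamp 1); apply => /=.
  by rewrite minxx (max_idPr ler01).
- move=> s t s01 t01 /val_inj/(can_inj (bij_funK h)) /(congr1 val) /=.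
  move: s01 t01; rewrite !in_itv /= => /andP[s0 s1] /andP[t0 t1].
  by rewrite (min_idPl s1) (max_idPr s0) (min_idPl t1) (max_idPr t0).
apply/seteqP; split=> [z Az|_ [t t01 <-]].
  pose a : A := exist (fun z => z \in A) z (mem_set Az).
  exists (val (bij_inv h a)); last by rewrite clampE bij_invK.
  by have := valP (bij_inv h a); rewrite inE.
exact/set_mem/(valP (h (clamp t))).
Qed.

Lemma path_connected (f : R -> X) (s t : R) : continuous f ->
  connected (f @` `[s, t]).
Proof.
move=> fc.
apply: connected_continuous_connected; first exact: segment_connected.
exact: continuous_subspaceT.
Qed.

Lemma open_arc_path (x y z : X) : open_arc R x y z -> exists f : R -> X,
  [/\ continuous f, f 0 = x, f 1 = y,
      {in `[0, 1] &, injective f} & exists2 t, t \in `[0, 1] & f t = z].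
Proof.
move=> [az _].
(* The default value of [arc] is the empty set, so a point in it proves that an arc exists. *)
have /(xgetPex set0)/arc_path[f [fc f0 f1 finj fA]] : exists A, is_arc R x y A.
  apply: contrapT => no; move: az.
  by rewrite /Defs.arc xgetPN// => A; apply: contra_not no; exists A.
exists f; split=> //; move: az; rewrite /Defs.arc fA => -[t t01 <-].
by exists t.
Qed.

(** The path from [p] to [z] must meet [w], so by injectivity the remaining path from [z] to [q]
    does not. *)
Lemma open_arc_separation (p q z w : X) : open_arc R p q z ->
  z <> w -> ~ side w p z -> side w z q.
Proof.
move=> /open_arc_path[f [fc f0 f1 finj [t t01 fz]]] zw npz.
have := t01; rewrite in_itv /= => /andP[t0 t1].
have [s s0t fs] : exists2 s, s \in `[0, t] & f s = w.
  apply: contrapT => no; apply: npz.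
  apply: (@side_max _ _ _ (f @` `[0, t])); first exact: path_connected.
  - by exists 0 => //=; rewrite in_itv /= lexx.
  - by move=> [s s0t e]; apply: no; exists s.
  - by exists t => //=; rewrite in_itv /= t0 lexx.
apply: (@side_max _ _ _ (f @` `[t, 1])); first exact: path_connected.
- by exists t => //=; rewrite in_itv /= t1 lexx.
- move=> [r /=]; rewrite in_itv /= => /andP[tr r1] e.
  move: s0t; rewrite in_itv /= => /andP[s0 st].
  have rs : r = s.
    apply: finj; rewrite ?e ?fs// in_itv /=.
      by rewrite (le_trans t0 tr) r1.
    by rewrite s0 (le_trans st t1).
  by apply: zw; rewrite -fs -fz; congr f; apply: le_anti; rewrite -{1}rs tr st.
- by exists 1 => //=; rewrite in_itv /= t1 lexx.
Qed.

Lemma open_arc_separation2 (p z z' w : X) : open_arc R p z z' ->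
  z' <> w -> z <> w -> ~ side w z' z -> side w p z'.
Proof.
move=> /open_arc_path[f [fc f0 f1 finj [t t01 fz]]] z'w zw npz.
have := t01; rewrite in_itv /= => /andP[t0 t1].
have [s s0t fs] : exists2 s, s \in `[t, 1] & f s = w.
  apply: contrapT => no; apply: npz.
  apply: (@side_max _ _ _ (f @` `[t, 1])); first exact: path_connected.
  - by exists t => //=; rewrite in_itv /= t1 lexx.
  - by move=> [s s0t e]; apply: no; exists s.
  - by exists 1 => //=; rewrite in_itv /= t1 lexx.
apply: (@side_max _ _ _ (f @` `[0, t])); first exact: path_connected.
- by exists 0 => //=; rewrite in_itv /= t0 lexx.
- move=> [r /=]; rewrite in_itv /= => /andP[r0 rt] e.
  move: s0t; rewrite in_itv /= => /andP[ts s1].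
  have rs : r = s.
    apply: finj; rewrite ?e ?fs// in_itv /=.
      by rewrite r0 (le_trans rt t1).
    by rewrite s1 (le_trans t0 ts).
  by apply: z'w; rewrite -fs -fz; congr f; apply: le_anti; rewrite -{2}rs ts rt.
- by exists t => //=; rewrite in_itv /= t0 lexx.
Qed.

End Arcs.

Section BranchPoints.
Variable X : topologicalType.
Implicit Types (w y z : X).

Lemma branch_pointP w : branch_points w <-> exists a b c,
  [/\ [/\ a <> w, b <> w & c <> w],
      ~ side w a b, ~ side w b c & ~ side w a c].
Proof.
split=> [/card_leP/injfunPex[f _ f_inj]|[a [b [c [[aw bw cw] ab bc ac]]]]].
  have /choice[r rP] (i : `I_3) : exists y, y <> w /\ side w y = val (f i).
    by have := valP (f i); rewrite inE => -[y yw e]; exists y.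
  pose o (i : nat) (i3 : (i < 3)%N) : `I_3 :=
    exist (fun i => i \in `I_3) i (mem_set i3).
  have h i j : i <> j -> ~ side w (r i) (r j).
    move=> ij /same_connected_component; apply: contra_not ij => e.
    apply: f_inj => //; rewrite ?inE//; apply: val_inj.
    by have [_ <-] := rP i; have [_ <-] := rP j.
  exists (r (@o 0%N isT)), (r (@o 1%N isT)), (r (@o 2%N isT)); split.
    by split; have [] := rP (@o 0%N isT); have [] := rP (@o 1%N isT);
      have [] := rP (@o 2%N isT).
  - by apply: h => /(congr1 val).
  - by apply: h => /(congr1 val).
  - by apply: h => /(congr1 val).
pose t (i : nat) : X := if i is 0%N then a else if i is 1%N then b else c.
have tw i : t i <> w by case: i => [|[|i]].
pose f (i : `I_3) : hat w := component_at (tw (val i)).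
apply/card_leP/injfunPex; exists f => // i j _ _ /(congr1 val) /= e.
have {e} : side w (t (val i)) (t (val j)).
  by rewrite /side e; exact: side_refl.
have := valP i; have := valP j; rewrite !inE /=.
case: i j => [i i3] [j j3] /= _ _ h; apply: val_inj => /=.
move: i3 j3 h; rewrite !inE /=.
by case: i => [|[|[|//]]] _; case: j => [|[|[|//]]] _ //= /side_sym.
Qed.

Lemma branch_point_three w z : branch_points w -> exists y y',
  [/\ y <> w, y' <> w, ~ side w z y, ~ side w z y' & ~ side w y y'].
Proof.
move=> /branch_pointP[a [b [c [[aw bw cw] ab bc ac]]]].
have t x y y' : side w x y -> side w x y' -> side w y y'.
  by move=> h; exact/side_trans/side_sym.
have [za|nza] := pselect (side w z a).
  by exists b, c; split=> // h; [apply: ab|apply: ac]; exact: t za h.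
have [zb|nzb] := pselect (side w z b); last by exists a, b.
by exists a, c; split=> // h; apply: bc; exact: t zb h.
Qed.

End BranchPoints.

(** * Baire category and countable bases in completely metrizable spaces *)

Section CompletelyMetrizable.
Local Open Scope ring_scope.
Variables (R : realType) (T : topologicalType).

Lemma completely_metrizable_metrizable :
  completely_metrizable R T -> metrizable R T.
Proof. by move=> [M hM _]; exists M. Qed.

(* [small k A] stands for "A lies in a ball of radius 1/(k+1)". *)
Lemma complete_small_sets : completely_metrizable R T ->
  exists small : nat -> set (set T),
    [/\ forall k A B, A `<=` B -> small k B -> small k A,
     forall k x U, nbhs x U ->
       exists V, [/\ open V, V x, closure V `<=` U & small k V] &
     forall A : nat -> set T, (forall k, A k !=set0) ->
       (forall k, A k.+1 `<=` A k) -> (forall k, small k (A k)) ->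
       exists l, (forall k, closure (A k) l) /\
         forall U, nbhs l U -> exists k, A k `<=` U].
Proof.
move=> [M [h [hc hc']] Mc].
have nbhs_h (x : T) (U : set T) : nbhs x U -> nbhs (h x) (bij_inv h @^-1` U).
  by move=> xU; apply: hc'; rewrite /= bij_funK.
exists (fun k A => exists x, A `<=` h @^-1` ball x k.+1%:R^-1); split.
- by move=> k A B AB [x Bx]; exists x => y /AB/Bx.
- move=> k x U xU.
  have := nbhs_h x U xU; rewrite -nbhs_ballE => -[e /= e0 eU].
  pose d := Num.min (e / 2) k.+1%:R^-1.
  have d0 : 0 < d by rewrite lt_min divr_gt0//= invr_gt0.
  exists (h @^-1` (ball (h x) d)°); split.
  + by apply: open_comp; [move=> y _; exact: hc | exact: open_interior].
  + exact: nbhsx_ballx.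
  + move=> y cy; rewrite -[y](bij_funK h); apply: eU.
    have [|z [zx zy]] := cy (h @^-1` (ball (h y) d)).
      by apply: hc; exact: nbhsx_ballx.
    rewrite (splitr e); apply: (@ball_triangle _ _ (h z)).
      by apply: le_ball (interior_subset zx); rewrite ge_min lexx.
    by apply: ball_sym; apply: le_ball zy; rewrite ge_min lexx.
  + exists (h x) => y /interior_subset; apply: le_ball.
    by rewrite ge_min lexx orbT.
move=> A A0 AS Asm.
have Amono k l : (k <= l)%N -> A l `<=` A k.
  elim: l => [|l IH]; first by rewrite leqn0 => /eqP ->.
  by rewrite leq_eqVlt => /predU1P[->//|/IH h1] x /AS/h1.
pose F : set_system M := filter_from [set: nat] (fun k => bij_inv h @^-1` A k).
have FF : ProperFilter F.
  apply: filter_from_proper; last first.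
    by move=> k _; have [x Ax] := A0 k; exists (h x); rewrite /= bij_funK.
  apply: filter_from_filter; first by exists 0%N.
  move=> k l _ _; exists (maxn k l) => // x /= Ax; split; apply: Amono Ax.
    exact: leq_maxl.
  exact: leq_maxr.
have [|l Fl] := Mc F FF.
  apply: cauchy_exP => e e0; have [k ke] := inv_succ_lt e0.
  have [x Ax] := Asm k; exists x; exists k => // y /Ax /=; rewrite bij_invK.
  by apply: le_ball; exact: ltW.
have lP U : nbhs (bij_inv h l) U -> exists k, A k `<=` U.
  move=> /nbhs_h; rewrite bij_invK => /Fl[k _ kU]; exists k => x Ax.
  by rewrite -[x](bij_funK h); apply: kU; rewrite /= bij_funK.
exists (bij_inv h l); split=> // k U /lP[j jU].
have [x Ax] := A0 (maxn k j); exists x; split.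
  by apply: Amono Ax; exact: leq_maxl.
by apply: jU; apply: Amono Ax; exact: leq_maxr.
Qed.

Lemma complete_baire (I : countType) (O : I -> set T) :
  completely_metrizable R T ->
  (forall i, open (O i)) -> (forall i, dense (O i)) -> dense (\bigcap_i O i).
Proof.
move=> /complete_small_sets[small [_ nest lim]] oO dO U [x0 Ux0] oU.
pose O' k := if unpickle k is Some i then O i else setT.
have oO' k : open (O' k).
  by rewrite /O'; case: unpickle => // ; exact: openT.
have dO' k : dense (O' k).
  by rewrite /O'; case: unpickle => // W W0 _; rewrite setIT.
pose ok (V : set T) := open V /\ V !=set0.
have step k (V : {V | ok V}) : exists V' : {V | ok V},
    closure (proj1_sig V') `<=` proj1_sig V `&` O' k /\ small k (proj1_sig V').
  case: V => V [oV V0] /=.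
  have [x [Vx Ox]] := dO' k V V0 oV.
  have [W [oW Wx cW sW]] := nest k x (V `&` O' k)
    (filterI (open_nbhs_nbhs (conj oV Vx)) (open_nbhs_nbhs (conj (oO' k) Ox))).
  have okW : ok W by split=> //; exists x.
  by exists (exist ok W okW).
pose next k V := proj1_sig (cid (step k V)).
have okU : ok U by split=> //; exists x0.
pose S := fix S k := if k is j.+1 then next j (S j) else exist ok U okU.
pose A k := proj1_sig (S k.+1).
have SP k : closure (A k) `<=` proj1_sig (S k) `&` O' k /\ small k (A k).
  by rewrite /A /= /next; case: cid.
have [||k|l [lA _]] := lim A.
- by move=> k; have [_] := proj2_sig (S k.+1).
- by move=> k x /subset_closure /(SP k.+1).1[].
- exact: (SP k).2.
exists l; split; first by have /(SP 0%N).1[] := lA 0%N.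
move=> i _; have /(SP _).1[_] := lA (pickle i).
by rewrite /O' pickleK.
Qed.

Lemma separable_basis : completely_metrizable R T -> separable T ->
  exists2 B : nat * nat -> set T, (forall i, open (B i)) &
    forall x U, nbhs x U -> exists i, B i x /\ B i `<=` U.
Proof.
move=> [M [h [hc hc']] _] [D /countable_injP[f f_inj] dD].
have oball (x : T) (e : R) : open (h @^-1` (ball (h x) e)°).
  by apply: open_comp; [move=> y _; exact: hc | exact: open_interior].
(* As [f] is injective on [D], this union has at most one term; it is empty if [i.1] codes no point
   of [D]. *)
exists (fun i => \bigcup_(d in [set d | D d /\ f d = i.1])
    (h @^-1` (ball (h d) i.2.+1%:R^-1)°)).
  by move=> i; apply: bigcup_open => d _; exact: oball.
move=> x U xU.
have : nbhs (h x) (bij_inv h @^-1` U) by apply: hc'; rewrite /= bij_funK.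
rewrite -nbhs_ballE => -[e /= e0 eU].
have [k ke] : exists k, k.+1%:R^-1 < e / 2.
  by apply: inv_succ_lt; rewrite divr_gt0.
have k0 : 0 < k.+1%:R^-1 :> R by rewrite invr_gt0.
have [d [Dd Wd]] : exists d, D d /\ (ball (h d) k.+1%:R^-1)° (h x).
  have [|d [/interior_subset/ball_sym dx Dd]] := dD _ _ (oball x k.+1%:R^-1).
    by exists x; exact: nbhsx_ballx.
  exists d; split=> //; move: dx; rewrite ballEmdist /= => dx.
  rewrite /interior -nbhs_ballE.
  exists (k.+1%:R^-1 - mdist (h d) (h x)); first by rewrite /= subr_gt0.
  move=> y; rewrite !ballEmdist /= ltrBrDl; apply: le_lt_trans.
  exact: metric_triangle.
exists (f d, k); split; first by exists d.
move=> y [d' [Dd' fd']] /interior_subset.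
have -> : d' = d by apply: f_inj => //; exact: mem_set.
move=> dy; rewrite -[y](bij_funK h); apply: eU.
rewrite (splitr e); apply: (@ball_triangle _ _ (h d)).
  by apply: ball_sym; apply: le_ball (interior_subset Wd); exact: ltW.
by apply: le_ball dy; exact: ltW.
Qed.

End CompletelyMetrizable.

(** * Polish group topologies *)

Section GroupTopology.
Variables (R : realType) (G : groupType) (tau : topology_on G).
Let T := with_topology tau.
Hypothesis tau_polish : polish_group_topology R tau.
Implicit Types (g h x y : G) (A U : set G).

Lemma gt_hausdorff : hausdorff_space T.
Proof.
have [_ _ _] := tau_polish.
by move=> /completely_metrizable_metrizable/metrizable_hausdorff.
Qed.

Lemma gt_nbhsI x A U :
  nbhs (x : T) A -> nbhs (x : T) U -> nbhs (x : T) (A `&` U).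
Proof. exact: (@filterI T (nbhs (x : T)) (nbhs_filter (x : T))). Qed.

Lemma gt_mul x y U : nbhs ((x * y)%g : T) U -> exists A B,
  [/\ nbhs (x : T) A, nbhs (y : T) B & forall a b, A a -> B b -> U (a * b)%g].
Proof.
have [mc _ _ _] := tau_polish => xyU.
have [[A B] /= [xA yB] AB] := mc (x, y) U xyU.
by exists A, B; split=> // a b Aa Bb; apply: (AB (a, b)).
Qed.

Lemma gt_inv x U : nbhs ((x^-1)%g : T) U -> nbhs (x : T) [set y | U (y^-1)%g].
Proof. by have [_ ic _ _] := tau_polish; exact: ic. Qed.

Lemma gt_mull x y U :
  nbhs ((x * y)%g : T) U -> nbhs (y : T) [set z | U (x * z)%g].
Proof.
move=> /gt_mul[A [B [/nbhs_singleton Ax yB AB]]].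
by apply: (filterS _ yB) => z Bz; exact: AB.
Qed.

Lemma gt_mulr x y U :
  nbhs ((x * y)%g : T) U -> nbhs (x : T) [set z | U (z * y)%g].
Proof.
move=> /gt_mul[A [B [xA /nbhs_singleton By AB]]].
by apply: (filterS _ xA) => z Az; exact: AB.
Qed.

Lemma gt_open_mull x U :
  open (U : set T) -> open ([set z | U (x * z)%g] : set T).
Proof.
by rewrite !openE => oU y /oU; exact: gt_mull.
Qed.

Lemma gt_baire_cover (I : countType) (F : I -> set G) :
  (forall x, exists i, F i x) ->
  exists i x, nbhs (x : T) (closure (F i : set T)).
Proof.
move=> cov; apply: contrapT => no.
have [_ _ _ cm] := tau_polish.
have [||y [_ yP]] := @complete_baire R T I
    (fun i => ~` closure (F i : set T)) cm _ _
    setT (ex_intro _ (1%g : T) Logic.I) openT.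
- by move=> i; rewrite openC; exact: closed_closure.
- move=> i U [x Ux] oU; apply: contrapT => noU; apply: no; exists i, x.
  apply: (@filterS _ _ _ U); last exact: open_nbhs_nbhs.
  by move=> y Uy; apply: contrapT => ny; apply: noU; exists y.
by have [i Fi] := cov y; apply: (yP i Logic.I); exact: subset_closure.
Qed.

(** By Baire, one of the countably many closed cosets has an interior point, which translations
    carry to every point of [N]. *)
Lemma countable_index_open (N : set G) (e : nat -> G) :
  closed (N : set T) -> (forall g h, N g -> N h -> N (g^-1 * h)%g) ->
  (forall g, exists k, N ((e k)^-1 * g)%g) -> open (N : set T).
Proof.
move=> cN Nsub Ncov.
have [k [x]] :=
  @gt_baire_cover nat (fun k => [set g | N ((e k)^-1 * g)%g]) Ncov.
rewrite -(closure_id _).1; last first.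
  rewrite -openC; apply: (@gt_open_mull _ (~` N)); first by rewrite openC.
move=> xN; rewrite openE => g Ng.
have Nx : N ((e k)^-1 * x)%g by exact: nbhs_singleton xN.
have : nbhs ((x * g^-1 * g)%g : T) [set g | N ((e k)^-1 * g)%g].
  by rewrite mulgVK.
move=> /gt_mull; apply: filterS => y /= Ny.
have N1 : N 1%g by rewrite -(mulVg g); exact: Nsub.
have NV h : N h -> N h^-1%g by move=> Nh; rewrite -[h^-1%g]mulg1; exact: Nsub.
have := Nsub _ _ Nx Ny; rewrite -(mulgA x) (mulgA (e k)^-1%g x) mulKg.
by move=> /(Nsub _ _ (NV _ Ng)); rewrite invgK mulVKg.
Qed.

End GroupTopology.

(** * Comparable Polish group topologies coincide *)

Section Comparison.
Variables (R : realType) (G : groupType) (tau tau' : topology_on G).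
Let T := with_topology tau.
Let T' := with_topology tau'.
Hypothesis tau_polish : polish_group_topology R tau.
Hypothesis tau'_polish : polish_group_topology R tau'.
Hypothesis tau_coarser : top_open tau `<=` top_open tau'.
Implicit Types (g h x y : G) (A U : set G).

Let openTT' U : open (U : set T) -> open (U : set T').
Proof. exact: tau_coarser. Qed.

Let cl A : set G := closure (A : set T).

(** The [tau]-interior of the [tau]-closure, a [tau]-open set to be compared with [A] when [A] is
    [tau']-open. *)
Let W A : set G := [set x | nbhs (x : T) (cl A)].

Let W_open A : open (W A : set T).
Proof. exact: open_interior. Qed.

Let W_sub A : W A `<=` cl A.
Proof. by move=> x; exact: nbhs_singleton. Qed.

Let W_nbhs A x : W A x -> nbhs (x : T) (W A).
Proof. by move=> Wx; apply: open_nbhs_nbhs; split => //; exact: W_open. Qed.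

Let W_mull x A y U : W A y -> (forall z, A z -> U (x * z)%g) -> W U (x * y)%g.
Proof.
move=> Ay AU; apply: (@filterS T _ _ [set z | cl A (x^-1 * z)%g]).
  move=> z Az N zN; have [|t [At Nt]] := Az [set t | N (x * t)%g].
    by apply: (gt_mull tau_polish); rewrite mulVKg.
  by exists (x * t)%g; split=> //; exact: AU.
by apply: (gt_mull tau_polish); rewrite mulKg.
Qed.

Let gt_divl g U : nbhs (g : T') U -> exists N,
  [/\ nbhs (1%g : T') N & forall a b, N a -> N b -> U (g * (a^-1 * b))%g].
Proof.
have -> : nbhs (g : T') U = nbhs ((g * (1%g^-1 * 1))%g : T') U.
  by rewrite invg1 !mulg1.
move=> /(gt_mull tau'_polish)/(gt_mul tau'_polish)[A [B [+ nB AB]]].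
move=> /(gt_inv tau'_polish) nA.
exists ([set a | A a^-1%g] `&` B); split; first exact: (gt_nbhsI nA nB).
by move=> a b [Aa _] [_ Bb]; exact: AB.
Qed.

Let gt_divr g U : nbhs (g : T') U -> exists N,
  [/\ nbhs (1%g : T') N & forall a b, N a -> N b -> U (a * b^-1 * g)%g].
Proof.
have -> : nbhs (g : T') U = nbhs ((1%g * 1%g^-1 * g)%g : T') U.
  by rewrite invg1 !mul1g.
move=> /(gt_mulr tau'_polish)/(gt_mul tau'_polish)[A [B [nA + AB]]].
move=> /(gt_inv tau'_polish) nB.
exists (A `&` [set a | B a^-1%g]); split; first exact: (gt_nbhsI nA nB).
by move=> a b [Aa _] [_ Bb]; exact: AB.
Qed.

(** By separability of [tau'], countably many translates of [N] cover the group, so Baire for [tau]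
    makes [W N] nonempty and gives a [v] in [N] with [W N v]. Translation by [g * v^-1] takes [v] to
    [g] and [N] into [U]. *)
Let open_sub_W U : open (U : set T') -> U `<=` W U.
Proof.
rewrite openE => oU g /oU /gt_divl[N [nN NU]].
have [_ _ [D /countable_injP[f f_inj] dD] _] := tau'_polish.
have [x | k [x xW]] := @gt_baire_cover R G tau tau_polish nat
    (fun k => [set x | exists d, [/\ D d, f d = k & N (d^-1 * x)%g]]).
  have [d [dN Dd]] : exists d, N (d^-1 * x)%g /\ D d.
    have nx : nbhs (x : T') [set d | N (d^-1 * x)%g].
      apply: (gt_inv tau'_polish (U := [set e | N (e * x)%g])).
      by apply: (gt_mulr tau'_polish); rewrite mulVg.
    move: nx; rewrite nbhsE => -[Z [oZ Zx] ZN].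
    have [d [Zd Dd]] := dD Z (ex_intro _ x Zx) oZ.
    by exists d; split=> //; exact: ZN.
  by exists (f d), d.
have [d [Dd fd]] : exists d, D d /\ f d = k.
  by have [y [[d [Dd fd _]] _]] := nbhs_singleton xW _ filterT; exists d.
have WN : W N (d^-1 * x)%g.
  apply: (W_mull xW) => z [d' [Dd' fd' Nz]].
  by rewrite (_ : d = d')//; apply: f_inj; [exact: mem_set..|rewrite fd].
have [v [Nv Wv]] := W_sub WN (W_nbhs WN).
rewrite -[g]mulg1 -(mulVg v) mulgA; apply: (W_mull Wv) => z Nz.
by rewrite -mulgA; exact: NU.
Qed.

(* For [B] in a countable base of the finer topology, all points of [W B]
   outside of a meagre set [~` Y] lie in [B]: such a point is in [W B_k] for a
   nested sequence of small basic sets [B_k], which shrinks to it. *)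
Let generic_points : exists O : nat * (nat * nat) -> set G,
  [/\ forall i, open (O i : set T), forall i, dense (O i : set T) &
   forall x U, nbhs (x : T') U -> exists B,
     [/\ open (B : set T'), B x, B `<=` U &
         forall y, (forall i, O i y) -> W B y -> B y]].
Proof.
have [_ _ sep' cm'] := tau'_polish.
have [B oB Bbase] := separable_basis cm' sep'.
have [small [sm_mono nest lim]] := complete_small_sets cm'.
pose sub k i j := closure (B j : set T') `<=` B i /\ small k (B j).
exists (fun t =>
  ~` cl (W (B t.2)) `|` \bigcup_(j in [set j | sub t.1 t.2 j]) W (B j)).
split.
- move=> [k i]; apply: openU; first by rewrite openC; exact: closed_closure.
  by apply: bigcup_open => j _; exact: W_open.
(* Density: a nonempty [tau]-open part of [W (B i)] contains some [b] in [B i], and a small basic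
   [B j] around [b] satisfies [W (B j) b]. *)
- move=> [k i] U [x Ux] oU /=.
  have [nc|/contrapT cx] := pselect (~ cl (W (B i)) x).
    by exists x; split=> //; left.
  have [z [Wz Uz]] := cx U (open_nbhs_nbhs (conj oU Ux)).
  have [b [Bb Ub]] := W_sub Wz (open_nbhs_nbhs (conj oU Uz)).
  have nb : nbhs (b : T') (B i) by apply: open_nbhs_nbhs; split=> //; exact: oB.
  have [V [oV Vb cV sV]] := nest k b (B i) nb.
  have [j [Bjb BjV]] := Bbase b V (open_nbhs_nbhs (conj oV Vb)).
  exists b; split=> //; right; exists j; last exact: open_sub_W.
  by split; [exact: subset_trans (closureS BjV) cV|exact: sm_mono BjV sV].
move=> x U /Bbase[i [Bx BU]]; exists (B i); split=> // y yO Wy.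
have step (k : nat) (s : {j | W (B j) y}) : exists s' : {j | W (B j) y},
    sub k (proj1_sig s) (proj1_sig s').
  case: s => j Wj /=; have [|[j' jj' Wj']] := yO (k, j).
    by case; apply: subset_closure.
  by exists (exist (fun j => W (B j) y) j' Wj').
pose next k s := proj1_sig (cid (step k s)).
pose S := fix S k := if k is l.+1 then next l (S l) else
  exist (fun j => W (B j) y) i Wy.
pose A k := B (proj1_sig (S k.+1)).
have SP k : sub k (proj1_sig (S k)) (proj1_sig (S k.+1)).
  by rewrite /= /next; case: cid.
have WA k : W (A k) y by exact: (proj2_sig (S k.+1)).
have [k|k z Az|k|l [lA lU]] := lim A.
- by have [z [Az _]] := W_sub (WA k) (@filterT _ _ _); exists z.
- by apply: (SP k.+1).1; exact: subset_closure.
- exact: (SP k).2.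
(* A [tau]-neighbourhood of [l] is also a [tau']-neighbourhood, so it contains some [A k]; and [y]
   is in the [tau]-closure of every [A k]. *)
suff -> : y = l by apply: (SP 0%N).1; exact: lA.
apply: (gt_hausdorff tau_polish) => P Q yP.
rewrite nbhsE => -[Q' [oQ' Q'l] Q'Q].
have [k AQ'] := lU Q' (open_nbhs_nbhs (conj (openTT' oQ') Q'l)).
have [z [Az Pz]] := W_sub (WA k) yP.
by exists z; split=> //; apply: Q'Q; exact: AQ'.
Qed.

(** A Pettis argument: for [s] in [W B], the intersection of [W B] with its translate by [s] is
    [tau]-open and contains [s], so by Baire it contains a [y] such that [y] and [s^-1 * y] are both
    generic. Both are then in [B], and [s] is their quotient. *)
Lemma polish_comparable : tau = tau'.
Proof.
apply: topology_onP; apply/seteqP; split=> // U oU.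
suff : open (U : set T) by [].
have [_ _ _ cm] := tau_polish.
have [Om [oO dO OP]] := generic_points.
rewrite openE => g Ug.
have [N [nN NU]] := gt_divr (open_nbhs_nbhs (conj (oU : open (U : set T')) Ug)).
have [B [oB B1 BN BP]] := OP _ _ nN.
have W1 : W B 1%g by exact: open_sub_W.
apply: (@filterS T _ _ [set x | W B (x * g^-1)%g]); last first.
  by apply: (gt_mulr tau_polish); rewrite mulgV; exact: W_nbhs.
move=> x Wx; set s := (x * g^-1)%g in Wx.
have xE : x = (s * g)%g by rewrite /s mulgVK.
pose O2 (t : bool * (nat * (nat * nat))) : set G :=
  if t.1 then Om t.2 else [set y | Om t.2 (s^-1 * y)%g].
have dY := @complete_baire R T _ O2 cm.
have [| | | |y [[Wy Wsy] yO]] := dY _ _ (W B `&` [set y | W B (s^-1 * y)%g]).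
- by case=> -[] i /=; [exact: oO|apply: (gt_open_mull tau_polish); exact: oO].
- case=> -[] i /=; first exact: dO.
  move=> P [z Pz] oP; have [||t [Pt Ot]] := dO i [set t | P (s * t)%g].
  + by exists (s^-1 * z)%g; rewrite /= mulVKg.
  + exact: (gt_open_mull tau_polish).
  by exists (s * t)%g; split=> //; rewrite /O2 /= mulKg.
- by exists s; split=> //=; rewrite mulVg.
- apply: openI; first exact: W_open.
  by apply: (gt_open_mull tau_polish); exact: W_open.
have By : B y by apply: BP => // i; exact: (yO (true, i)).
have Bsy : B (s^-1 * y)%g by apply: BP => // i; exact: (yO (false, i)).
have := NU _ _ (BN _ By) (BN _ Bsy).
by rewrite invgM invgK mulgA mulgV mul1g -xE.
Qed.

End Comparison.

(** * The metric of the first differing coordinate *)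

Section SequenceMetric.
Local Open Scope ring_scope.
Variables (R : realType) (T : choiceType) (A : eqType) (F : T -> nat -> A).
Hypothesis F_inj : forall x y, (forall i, F x i = F y i) -> x = y.
Implicit Types (x y z : T) (i k : nat).

Definition seq_dist x y : R :=
  if pselect (exists i, F x i != F y i) is left xy
  then (ex_minn xy).+1%:R^-1 else 0.

Lemma seq_dist_lt x y k :
  seq_dist x y < k.+1%:R^-1 <-> forall i, (i <= k)%N -> F x i = F y i.
Proof.
rewrite /seq_dist; case: pselect => [xy|nxy]; last first.
  split=> // _ i _; apply/eqP; apply: contrapT => /negP ne.
  by apply: nxy; exists i.
case: ex_minnP => m mP mmin.
rewrite ltf_pV2 ?posrE// ltr_nat ltnS; split=> [km i ik|h].
  apply/eqP; apply: contraTT km => /mmin mi.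
  by rewrite -leqNgt (leq_trans mi).
by rewrite ltnNge; apply: contra mP => mk; rewrite h.
Qed.

Lemma seq_dist_ge0 x y : 0 <= seq_dist x y.
Proof. by rewrite /seq_dist; case: pselect. Qed.

Lemma seq_distxx x : seq_dist x x = 0.
Proof.
rewrite /seq_dist; case: pselect => // ex.
by exfalso; case: ex => i; rewrite eqxx.
Qed.

Lemma seq_dist_eq0 x y : seq_dist x y = 0 -> x = y.
Proof.
by move=> d0; apply: F_inj => i; apply: (seq_dist_lt x y i).1; rewrite ?d0.
Qed.

Lemma seq_dist_sym x y : seq_dist x y = seq_dist y x.
Proof.
wlog le_xy : x y / seq_dist x y <= seq_dist y x.
  by move=> h; have [/h|/ltW/h] := leP (seq_dist x y) (seq_dist y x).
apply/le_anti; rewrite le_xy /= leNgt; apply/negP => {le_xy}.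
rewrite {2}/seq_dist; case: pselect => [yx|nyx]; last first.
  by rewrite ltNge seq_dist_ge0.
case: ex_minnP => m mP _ /seq_dist_lt /(_ m (leqnn m)) e.
by rewrite e eqxx in mP.
Qed.

Lemma seq_dist_triangle y x z : seq_dist x z <= seq_dist x y + seq_dist y z.
Proof.
rewrite {1}/seq_dist; case: pselect => [xz|_]; last first.
  by rewrite addr_ge0// seq_dist_ge0.
case: ex_minnP => m mP _; rewrite leNgt; apply/negP => lt_m.
have xy : seq_dist x y < m.+1%:R^-1.
  by apply: le_lt_trans lt_m; rewrite lerDl seq_dist_ge0.
have yz : seq_dist y z < m.+1%:R^-1.
  by apply: le_lt_trans lt_m; rewrite lerDr seq_dist_ge0.
move: mP; rewrite (iffLR (seq_dist_lt _ _ _) xy m (leqnn m)).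
by rewrite (iffLR (seq_dist_lt _ _ _) yz m (leqnn m)) eqxx.
Qed.

(* The vacuous [let]s make the alias depend on [R] and [F_inj], so that its
   metric is found by instance inference. *)
Definition seq_metric_space : Type := let _ := R in let _ := F_inj in T.

HB.instance Definition _ := Choice.copy seq_metric_space T.
HB.instance Definition _ := @isMetric.Build R seq_metric_space seq_dist
  seq_distxx seq_dist_eq0 seq_dist_sym seq_dist_triangle.

Lemma seq_ballP (x y : seq_metric_space) k :
  ball x (k.+1%:R^-1 : R) y <-> forall i, (i <= k)%N -> F x i = F y i.
Proof. by rewrite ballEmdist; exact: seq_dist_lt. Qed.

Lemma seq_nbhsP (x : seq_metric_space) (U : set seq_metric_space) :
  nbhs x U <->
  exists k, forall y, (forall i, (i <= k)%N -> F x i = F y i) -> U y.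
Proof.
rewrite -nbhs_ballE; split=> [[e /= e0 eU]|[k kU]].
  exists (Num.truncn e^-1) => y xy; apply: eU.
  apply: (@le_ball _ _ _ (Num.truncn e^-1).+1%:R^-1); last exact/seq_ballP.
  by rewrite invf_ple ?posrE//; apply: ltW; exact: truncnS_gt.
by exists k.+1%:R^-1; rewrite /= ?invr_gt0// => y /seq_ballP/kU.
Qed.

Lemma seq_completely_metrizable (tau : topology_on T) :
  (forall (x : with_topology tau) (U : set (with_topology tau)), nbhs x U <->
     exists k, forall y, (forall i, (i <= k)%N -> F x i = F y i) -> U y) ->
  (forall f, (forall k, exists x, forall i, (i <= k)%N -> F x i = f i) ->
     exists x, forall i, F x i = f i) ->
  completely_metrizable R (with_topology tau).
Proof.
move=> tauP F_complete; exists seq_metric_space.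
  exists (@Bijection (with_topology tau) seq_metric_space id id
    (fun=> erefl) (fun=> erefl)).
  by split=> x U /=; [move/seq_nbhsP/tauP | move/tauP/seq_nbhsP].
move=> Phi FF /cauchyP cPhi.
have /choice[x xP] k :
  exists x : seq_metric_space, Phi (ball x (k.+1%:R^-1 : R)) by apply: cPhi.
have xx i k : (i <= k)%N -> F (x k) i = F (x i) i.
  move=> ik; have [y [yi yk]] := filter_ex (filterI (xP i) (xP k)).
  by rewrite (iffLR (seq_ballP _ _ _) yk i ik) (iffLR (seq_ballP _ _ _) yi i).
(* Coordinate [i] of the limit is read off the ball of radius [1/(i+1)], on which it is constant. *)
have [l lP] : exists l, forall i, F l i = F (x i) i.
  by apply: F_complete => k; exists (x k) => i; exact: xx.
exists l => U /seq_nbhsP[k kU]; apply: filterS (xP k) => y /seq_ballP xy.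
by apply: kU => i ik; rewrite lP -(xx i k)// xy.
Qed.

End SequenceMetric.

(** The pointwise fixators of finite sets generate a filter converging to 1, so one of them lies in
    a neighbourhood [W] that isolates 1 in [Gamma]. *)
Lemma discrete_fixator (n : option nat) (Gamma : groupClosed (sym n)) :
  discrete_subset [set` Gamma] -> exists s : seq (bracket n),
    forall g : sym n, g \in Gamma -> (forall i, i \in s -> g i = i) -> g = 1%g.
Proof.
move=> /(_ 1%g); rewrite /= gpred1 => /(_ isT)[_ [W W1 WG]].
pose Phi : set_system (sym n) := filter_from [set: seq (bracket n)]
  (fun s => [set g : sym n | forall i, i \in s -> g i = i]).
have FPhi : Filter Phi.
  apply: filter_from_filter; first by exists [::].
  move=> s t _ _; exists (s ++ t) => // g gst.
  by split=> i ist; apply: gst; rewrite mem_cat ist ?orbT.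
suff [s _ sW] : Phi W.
  exists s => g gG gs; suff : [set (1%g : sym n)] g by [].
  by rewrite -WG; split=> //; exact: sW.
move: W1; rewrite nbhsE => -[_ [[B oB <-] B1] BW].
apply: (filterS BW).
pose ev : sym n -> {ptws bracket n -> discrete_topology (bracket n)} :=
  fun s => (s : bracket n -> bracket n).
suff : ev @ Phi --> ev 1%g.
  by apply; apply: open_nbhs_nbhs; split.
apply/pointwise_cvgP => i U.
move=> /nbhs_singleton Ui; exists [:: i] => // g /(_ i) gi.
by rewrite /= /ev gi ?mem_head.
Qed.

(** * Branch points of a kaleidoscopically coloured dendrite *)

Lemma two_colors (n : option nat) (i : bracket n) :
  (if n is Some k then (3 <= k)%N else true) -> exists j : bracket n, j != i.
Proof.
move=> n3.
have h k : (k < 3)%N -> k \in bracket n.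
  by rewrite inE; case: n n3 {i} => //= m m3 k3; exact: leq_trans k3 m3.
have [e|ne] := eqVneq (exist (fun k => k \in bracket n) 0 (h 0 isT)) i.
  by exists (exist (fun k => k \in bracket n) 1 (h 1 isT)); rewrite -e.
by exists (exist (fun k => k \in bracket n) 0 (h 0 isT)).
Qed.

Lemma exists_two_colors (n : option nat) :
  (if n is Some k then (3 <= k)%N else true) ->
  exists i j : bracket n, i <> j.
Proof.
move=> n3; have i0 : 0 \in bracket n.
  by rewrite inE; case: n n3 => //= k /ltnW/ltnW.
have [j ji] := two_colors (exist (fun k => k \in bracket n) 0 i0) n3.
by exists j, (exist (fun k => k \in bracket n) 0 i0); apply/eqP.
Qed.

Section Wazewski.
Variables (R : realType) (n : option nat)
  (n_ge3 : if n is Some k then (3 <= k)%N else true)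
  (X : topologicalType) (X_Dn : wazewski_dendrite R n X)
  (c : coloring n X) (c_kaleidoscopic : kaleidoscopic R c).
Let V : choiceType := @branch_points X.
Implicit Types (x y z p q : X) (u v w : V).

Lemma Dn_compact : compact [set: X]. Proof. by have [[[]]] := X_Dn. Qed.
Lemma Dn_connected : connected [set: X]. Proof. by have [[[]]] := X_Dn. Qed.
Lemma Dn_metrizable : metrizable R X. Proof. by have [[[]]] := X_Dn. Qed.
Lemma Dn_loc_connected : locally_connected X.
Proof. by have [[_ []]] := X_Dn. Qed.
Lemma Dn_hausdorff : hausdorff_space X.
Proof. exact: metrizable_hausdorff Dn_metrizable. Qed.

Definition col v y : option (bracket n) :=
  if pselect (y <> val v) is left yv then Some (color_at c yv) else None.

Lemma col_None v y : col v y = None <-> y = val v.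
Proof. by rewrite /col; case: pselect => // /contrapT. Qed.

Lemma color_atE v y (yv : y <> val v) : col v y = Some (color_at c yv).
Proof.
by rewrite /col; case: pselect => // yv'; rewrite (Prop_irrelevance yv yv').
Qed.

Lemma col_side v y z : side (val v) y z -> col v y = col v z.
Proof.
move=> h; rewrite (color_atE (side_neql h)) (color_atE (side_neq h)).
by congr (Some (c _ _)); apply: val_inj; exact: same_connected_component.
Qed.

Lemma side_col v y z : y <> val v -> col v y = col v z -> side (val v) y z.
Proof.
move=> yv; have [->|/eqP zv] := eqVneq z (val v).
  by have /col_None -> := erefl (val v); move/col_None.
rewrite (color_atE yv) (color_atE zv) => -[] /(can_inj (bij_funK (c v))) e0.
have /= e := congr1 val e0.
by rewrite /side e; exact: side_refl.
Qed.

(* A branch point [w] separating two branch points [z], [z'] of an arc from [p]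
   to [q] lies on this arc, which meets it only once; so [w] separates [p] from
   [q]. *)
Lemma branch_separation p q : p <> q ->
  exists w : X, [/\ branch_points w, p <> w, q <> w & ~ side w p q].
Proof.
have [_ _ _ arcB] := X_Dn; move=> pq.
have [z [pqz Bz]] := arcB _ _ pq.
have zp : p <> z by case: pqz => _ /= h e; apply: h; left.
have [z' [pzz' Bz']] := arcB _ _ zp.
have z'z : z' <> z by case: pzz' => _ /= h e; apply: h; right.
pose u : V := exist (fun y => y \in @branch_points X) z' (mem_set Bz').
pose v : V := exist (fun y => y \in @branch_points X) z (mem_set Bz).
have uv : u <> v by move/(congr1 val).
have [i0 [j0 ij]] := exists_two_colors n_ge3.
have [w [_ [uw [vw [e1 e2]]]]] := c_kaleidoscopic uv ij.
have nw : ~ side (val w) z' z.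
  by move=> /col_side; rewrite (color_atE uw) (color_atE vw) e1 e2 => -[].
have pz' : side (val w) p z' by apply: (open_arc_separation2 pzz').
have npz : ~ side (val w) p z.
  by move=> h; apply: nw; exact: side_trans (side_sym pz') h.
have zq : side (val w) z q by exact: (open_arc_separation pqz).
exists (val w); split.
- exact/set_mem/(valP w).
- exact: side_neql pz'.
- exact: side_neq zq.
- by move=> h; apply: npz; exact: side_trans h (side_sym zq).
Qed.

Lemma two_points : exists p : X * X, p.1 <> p.2.
Proof. by have [_ [p [q pq]] _ _] := X_Dn; exists (p, q). Qed.

Lemma branch_dense p (U : set X) : nbhs p U -> exists v, U (val v).
Proof.
have [[a b] ab] := two_points.
have := B_dense Dn_hausdorff Dn_connected Dn_loc_connected branch_separation ab.
move=> /[apply] -[b' Bb' Ub'].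
by exists (exist (fun y => y \in @branch_points X) b' (mem_set Bb')).
Qed.

(** The local form serves for maps known to agree only on the branch points of one component. *)
Lemma eq_on_dense (f g : X -> X) p (U : set X) :
  continuous f -> continuous g -> nbhs p U ->
  (forall v, U (val v) -> f (val v) = g (val v)) -> f p = g p.
Proof.
move=> fc gc Up fg; apply: Dn_hausdorff => A B nA nB.
have fA : nbhs p (f @^-1` A) by exact: fc.
have gB : nbhs p (g @^-1` B) by exact: gc.
have [v [Uv [Av Bv]]] := branch_dense (filterI Up (filterI fA gB)).
by exists (f (val v)); split=> //; rewrite fg.
Qed.

Lemma Dn_flip p q y : q <> p -> y <> p -> ~ side p y q -> side q p y.
Proof. exact: side_flip Dn_hausdorff Dn_connected Dn_loc_connected _ _ _. Qed.

Lemma Dn_side_nbhs p q y : side p q y -> nbhs y (side p q).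
Proof. exact: side_nbhs Dn_hausdorff Dn_loc_connected _ _ _. Qed.

Lemma branch_in_side p q : q <> p -> exists v, side p q (val v).
Proof.
by move=> qp; apply/branch_dense/Dn_side_nbhs; exact: side_refl.
Qed.

(** The topological median is one of the three points or has them in three different components of
    its complement; in the second case it is a branch point. *)
Lemma branch_median u v w : exists m,
  med (fun v u => col v (val u)) m u v w.
Proof.
have [q [h1 h2 h3]] := median Dn_hausdorff Dn_compact Dn_connected
  Dn_loc_connected branch_separation (val u) (val v) (val w).
suff [m mq] : exists m : V, val m = q.
  exists m; rewrite /med.
  have h s t : q = val s \/ q = val t \/ ~ side q (val s) (val t) ->
      btw (fun v u => col v (val u)) s m t.
    rewrite -mq => h; apply/implyP => /eqP e; apply/eqP.
    case: h => [/val_inj //|[h|h]]; apply: val_inj.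
      by move: e; rewrite ((col_None m (val t)).2 (esym h)) => /col_None.
    by apply: contrapT => ne; apply: h; apply: side_col => //; exact/not_eq_sym.
  by rewrite !h.
have [<-|qu] := pselect (val u = q); first by exists u.
have [<-|qv] := pselect (val v = q); first by exists v.
have [<-|qw] := pselect (val w = q); first by exists w.
have Bq : branch_points q.
  apply/branch_pointP; exists (val u), (val v), (val w); split=> //.
  - by case: h1 => [/esym//|[/esym//|]].
  - by case: h2 => [/esym//|[/esym//|]].
  - by case: h3 => [/esym//|[/esym//|]].
by exists (exist (fun y => y \in @branch_points X) q (mem_set Bq)).
Qed.

Lemma branch_kaleidoscopic u v i j : u <> v -> i <> j ->
  exists z : V, col z (val u) = Some i /\ col z (val v) = Some j.
Proof.
move=> uv ij; have [z [_ [uz [vz [<- <-]]]]] := c_kaleidoscopic uv ij.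
by exists z; rewrite (color_atE uz) (color_atE vz).
Qed.

Lemma branch_color v i : exists u, col v (val u) = Some i.
Proof.
have := valP (bij_inv (c v) i); rewrite inE => -[y yv e].
have [u yu] := branch_in_side yv.
exists u; rewrite -(col_side yu) (color_atE yv).
rewrite -[in RHS](bij_invK (c v) i); congr (Some (c _ _)).
by apply: val_inj.
Qed.

Lemma branch_enum : exists e : nat -> V, forall v, exists k, e k = v.
Proof.
have [[a b] ab] := two_points.
have := B_countable Dn_hausdorff Dn_connected Dn_loc_connected ab
  (@branch_point_three X)
  (compact_metrizable_separable Dn_compact Dn_metrizable).
move=> /countable_injP[f f_inj].
have [v0 _] := branch_dense (@filterT _ (nbhs a) _).
have /choice[e eP] k : exists v, forall u, f (val u) = k -> v = u.
  have [[u <-]|no] := pselect (exists u : V, f (val u) = k).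
    exists u => w e; apply: val_inj; apply: f_inj => //; exact: valP.
  by exists v0 => u fu; case: no; exists u.
by exists e => v; exists (f (val v)); exact: eP.
Qed.

Lemma col_sep u v w : u != v -> col u (val v) != col u (val w) ->
  col v (val u) = col v (val w).
Proof.
move=> uv /eqP ne; have [->//|uw] := eqVneq u w.
have nuv : val v <> val u by move=> /val_inj /esym/eqP; rewrite (negbTE uv).
have nuw : val w <> val u by move=> /val_inj /esym/eqP; rewrite (negbTE uw).
apply: col_side; apply: Dn_flip => //.
by move=> /side_sym/col_side.
Qed.

Lemma branch_automorphism v u u' :
  col v (val u) = col v (val u') -> col u (val v) = col u' (val v) ->
  exists f g : V -> V, [/\ cancel f g, cancel g f, f v = v, f u = u' &
    forall u w, col (f u) (val (f w)) = col u (val w)].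
Proof.
move=> vu uv; have [e e_surj] := branch_enum.
apply: (@col_automorphism V (bracket n) (fun v u => col v (val u))
  _ _ _ _ _ _ e) => //.
- move=> s t; apply/eqP/eqP; first by move/col_None/val_inj.
  by move->; apply/col_None.
- exact: col_sep.
- exact: branch_median.
- move=> s t i j /eqP st /eqP ij; exact: branch_kaleidoscopic.
- exact: branch_color.
- by move=> i; exact: two_colors.
Qed.

Lemma homeo_of_branch (f g : V -> V) : cancel f g -> cancel g f ->
  (forall u v w, side (val u) (val v) (val w) ->
     side (val (f u)) (val (f v)) (val (f w))) ->
  (forall u v w, side (val u) (val v) (val w) ->
     side (val (g u)) (val (g v)) (val (g w))) ->
  exists h : Homeo X, forall v, h (val v) = val (f v).
Proof.
move=> fK gK fc gc.
(* Only the values on branch points matter; elsewhere the identity is a default. *)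
pose ext (k : V -> V) x := if insub x is Some v then val (k v) else x.
have extE k v : ext k (val v) = val (k v) by rewrite /ext valK.
have toV x : branch_points x -> exists v : V, val v = x.
  by move=> Bx; exists (exist (fun y => y \in @branch_points X) x (mem_set Bx)).
have inV v : branch_points (val v) by exact/set_mem/(valP v).
have [[a b] ab] := two_points.
have [||||||h hh hf] := @extend_homeomorphism X Dn_hausdorff Dn_compact
  Dn_connected Dn_loc_connected _ branch_separation _ _ ab (ext f) (ext g).
- by move=> _ /toV[v <-]; rewrite extE; exact: inV.
- by move=> _ /toV[v <-]; rewrite extE; exact: inV.
- by move=> _ /toV[v <-]; rewrite !extE fK.
- by move=> _ /toV[v <-]; rewrite !extE gK.
- by move=> _ _ _ /toV[u <-] /toV[v <-] /toV[w <-]; rewrite !extE; exact: fc.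
- by move=> _ _ _ /toV[u <-] /toV[v <-] /toV[w <-]; rewrite !extE; exact: gc.
exists (exist (fun h => h \in @homeo_set X) h (asboolT hh)) => v.
by rewrite /homeo_fun /= hf ?extE//; exact: inV.
Qed.

Lemma homeo_side (h : Homeo X) x y z : side x y z -> side (h x) (h y) (h z).
Proof. by move=> xyz; apply: homeo_component_sub; exists z. Qed.

Lemma sigma_col (h : Homeo X) v y :
  col (homeo_branch h v) (h y) = omap (sigma c h v) (col v y).
Proof.
have [->|/eqP yv] := eqVneq y (val v).
  by rewrite ((col_None _ _).2 _)// ((col_None _ _).2 _).
have hyv : h y <> val (homeo_branch h v).
  by move=> /(can_inj (bij_funK h)).
rewrite (color_atE yv) (color_atE hyv) /=; congr (Some (c _ _)).
apply: val_inj => /=; rewrite bij_funK /=.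
exact/esym/homeo_component.
Qed.

Lemma sigma_ext (h : Homeo X) v (s : sym n) :
  (forall u, col (homeo_branch h v) (h (val u)) = omap s (col v (val u))) ->
  sigma c h v = s.
Proof.
move=> hs; apply: bijectionP => i; have [u ui] := branch_color v i.
by have := hs u; rewrite sigma_col ui => -[].
Qed.

(** * The pointwise topology on the kaleidoscopic group *)

Section Group.
Variable Gamma : groupClosed (sym n).
Let G := kaleidoscopic_group c Gamma.
Implicit Types (g h r : G).

Definition act g : X -> X := (val g : Homeo X).

Definition vact g : V -> V := homeo_branch (val g).

Lemma val_vact g v : val (vact g v) = act g (val v). Proof. by []. Qed.

Lemma actM g h p : act (g * h)%g p = act g (act h p). Proof. by []. Qed.

Lemma actVK g : cancel (act g) (act g^-1%g).
Proof. by move=> p; rewrite -actM mulVg. Qed.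

Lemma actKV g : cancel (act g^-1%g) (act g).
Proof. by move=> p; rewrite -actM mulgV. Qed.

Lemma act_inj g : injective (act g). Proof. exact: can_inj (actVK g). Qed.

Lemma act_continuous g : continuous (act g).
Proof. exact: homeo_continuous. Qed.

Lemma act_side g x y z : side (act g x) (act g y) (act g z) <-> side x y z.
Proof.
split; last exact: homeo_side.
move=> /(@homeo_side (val g^-1%g)).
by rewrite -/(act _ (act g x)) -/(act _ (act g y)) -/(act _ (act g z)) !actVK.
Qed.

Lemma vact1 v : vact 1%g v = v. Proof. exact: val_inj. Qed.

Lemma vactM g h v : vact (g * h)%g v = vact g (vact h v).
Proof. exact: val_inj. Qed.

Lemma vactVK g : cancel (vact g) (vact g^-1%g).
Proof. by move=> v; rewrite -vactM mulVg vact1. Qed.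

Lemma vactKV g : cancel (vact g^-1%g) (vact g).
Proof. by move=> v; rewrite -vactM mulgV vact1. Qed.

Lemma act_faithful g h : (forall v, vact g v = vact h v) -> g = h.
Proof.
move=> gh; apply: val_inj; apply: val_inj; apply: bijectionP => p.
apply: (@eq_on_dense (act g) (act h) p setT); [exact: act_continuous..| |].
  exact: filterT.
by move=> v _; rewrite -!val_vact gh.
Qed.

(** All local actions of the resulting homeomorphism are trivial, so it belongs to the group
    whatever [Gamma] is. *)
Lemma kaleidoscopic_of_branch (f g : V -> V) : cancel f g -> cancel g f ->
  (forall u w, col (f u) (val (f w)) = col u (val w)) ->
  exists r, forall v, vact r v = f v.
Proof.
move=> fK gK fcol.
have gcol u w : col (g u) (val (g w)) = col u (val w) by rewrite -fcol !gK.
have h_side (k k' : V -> V) : cancel k k' ->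
    (forall u w, col (k u) (val (k w)) = col u (val w)) ->
    forall u v w, side (val u) (val v) (val w) ->
     side (val (k u)) (val (k v)) (val (k w)).
  move=> kK kcol u v w h.
  apply: side_col; last by rewrite !kcol; exact: col_side.
  by move/val_inj/(can_inj kK) => e; apply: (side_neql h); rewrite e.
have [h hf] := homeo_of_branch fK gK (h_side _ _ fK fcol) (h_side _ _ gK gcol).
have hk : h \in kaleidoscopic_set c Gamma.
  apply/asboolP => v; rewrite (_ : sigma c h v = 1%g) ?gpred1//.
  apply: sigma_ext => u; rewrite (_ : homeo_branch h v = f v); last first.
    by apply: val_inj; exact: hf.
  by rewrite hf fcol; case: col.
exists (exist (fun h : Homeo X => h \in kaleidoscopic_set c Gamma) h hk) => v.
by apply: val_inj; exact: hf.
Qed.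

(* [z] and [z'] are branch points of the half-space which see [v] in the same
   colour; an automorphism [f] of the coloured tree fixing [v] and taking [z] to
   [z'] can be replaced by the identity outside of the half-space. *)
Lemma half_space_mover v y : y <> val v -> exists r,
  (forall p, ~ side (val v) y p -> act r p = p) /\
  exists2 p, side (val v) y p & act r p <> p.
Proof.
move=> yv; have [b yb] := branch_in_side yv.
have vb : v <> b by move=> e; apply: (side_neq yb); rewrite e.
have [i0 [j0 ij]] := exists_two_colors n_ge3.
have inside w (z : V) : v <> w ->
    col z (val v) = Some i0 -> col z (val w) = Some j0 ->
    side (val v) (val w) (val z).
  move=> vw e1 e2; apply: side_sym; apply: Dn_flip.
  - by move=> e; move: e1; rewrite ((col_None z (val v)).2 e).
  - by move=> e; move: e2; rewrite ((col_None z (val w)).2 e).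
  - by move=> /side_sym/col_side; rewrite e1 e2 => -[].
have [z [zv zb]] := branch_kaleidoscopic vb ij.
have bz := inside _ _ vb zv zb.
have vz : v <> z by move=> e; apply: (side_neq bz); rewrite e.
(* This [z'] is between [v] and [z], hence in the same component at [v], and sees [v] in the colour
   [i0] as [z] does. *)
have [z' [z'v z'z]] := branch_kaleidoscopic vz ij.
have zz' := inside _ _ vz z'v z'z.
have z'nz : z' <> z.
  by move=> e; move: z'z; rewrite e ((col_None z (val z)).2 erefl).
have [f [g [fK gK fv fz fcol]]] :=
  branch_automorphism (col_side zz') (etrans zv (esym z'v)).
pose D u := `[< side (val v) y (val u) >].
have gcol u w : col (g u) (val (g w)) = col u (val w) by rewrite -fcol !gK.
have gv : g v = v by rewrite -[in LHS]fv fK.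
have Dcol u w : col v (val u) = col v (val w) -> D u = D w.
  move=> e; apply/asboolP/asboolP => h; apply: (side_trans h);
    by apply: side_col => //; exact: side_neq h.
have Df u : D (f u) = D u by apply: Dcol; rewrite -{1}fv fcol.
have Dg u : D (g u) = D u by apply: Dcol; rewrite -{1}gv gcol.
pose F (k : V -> V) u := if D u then k u else u.
have FK (k k' : V -> V) : cancel k k' -> (forall u, D (k u) = D u) ->
    cancel (F k) (F k').
  move=> kK Dk u; rewrite /F; case: (boolP (D u)) => h.
    by rewrite Dk h kK.
  by rewrite (negbTE h).
have col_out u w : D u -> ~~ D w -> col u (val w) = col u (val v).
  move=> /asboolP Du /asboolP nDw; have [->//|/eqP vw] := eqVneq v w.
  apply: col_side; apply: side_sym; apply: Dn_flip.
  - exact: side_neq Du.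
  - by move/val_inj/esym.
  - by move=> h; apply: nDw; exact: side_trans Du (side_sym h).
have col_in u w : ~~ D u -> D w -> u <> v -> col u (val w) = col u (val v).
  move=> /asboolP nDu /asboolP Dw uv.
  apply: col_side; apply: side_sym; apply: Dn_flip.
  - by move/val_inj.
  - exact: side_neq Dw.
  - by move=> h; apply: nDu; exact: side_trans Dw h.
(* In the mixed cases a point of the half-space sees all outer points in the direction of [v], an
   outer point other than [v] sees the whole half-space in the direction of [v], and [f] fixes
   [v]. *)
have Fcol u w : col (F f u) (val (F f w)) = col u (val w).
  rewrite /F; case: ifPn => Du; case: ifPn => Dw //.
  - by rewrite col_out ?Df// -{1}fv fcol col_out.
  - have [->|/eqP uv] := eqVneq u v; first by rewrite -{1}fv fcol.
    by rewrite !col_in ?Df.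
have [r rF] := kaleidoscopic_of_branch (FK _ _ fK Df) (FK _ _ gK Dg) Fcol.
exists r; split=> [p np|].
  have [->|/eqP pv] := eqVneq p (val v).
    by rewrite -val_vact rF /F; case: ifPn => // _; rewrite fv.
  apply: (@eq_on_dense (act r) id p (side (val v) p)).
  - exact: act_continuous.
  - by move=> ?; exact: cvg_id.
  - by apply: Dn_side_nbhs; exact: side_refl.
  move=> u pu; rewrite -val_vact rF /F ifN//.
  by apply/asboolP => h; apply: np; exact: side_trans h (side_sym pu).
have Dz : D z by apply/asboolP; exact: side_trans yb bz.
exists (val z); first exact/asboolP.
by rewrite -val_vact rF /F Dz fz => /val_inj.
Qed.

Lemma sigma_vact g v y :
  col (vact g v) (act g y) = omap (sigma c (val g) v) (col v y).
Proof. exact: sigma_col. Qed.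

(** Inverses are approximated too, because a pointwise limit of permutations need not be
    surjective. *)
Lemma kaleidoscopic_closed (Gamma_discrete : discrete_subset [set` Gamma])
    (f f' : V -> V) :
  (forall s : seq V, exists g, forall v, v \in s ->
    vact g v = f v /\ vact g^-1%g v = f' v) ->
  exists g, forall v, vact g v = f v /\ vact g^-1%g v = f' v.
Proof.
move=> approx.
have fK : cancel f f'.
  move=> v; have [g gP] := approx [:: v; f v].
  have [|_ <-] := gP (f v); first by rewrite !inE eqxx orbT.
  have [<- _] := gP v (mem_head _ _).
  exact: vactVK.
have f'K : cancel f' f.
  move=> v; have [g gP] := approx [:: v; f' v].
  have [|<- _] := gP (f' v); first by rewrite !inE eqxx orbT.
  have [_ <-] := gP v (mem_head _ _).
  exact: vactKV.
have [|| h hf] := homeo_of_branch fK f'K.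
- move=> u v w uvw; have [g gP] := approx [:: u; v; w].
  have [<- _] := gP u (mem_head _ _).
  have [|<- _] := gP v; first by rewrite !inE eqxx orbT.
  have [|<- _] := gP w; first by rewrite !inE eqxx !orbT.
  by rewrite !val_vact act_side.
- move=> u v w uvw; have [g gP] := approx [:: u; v; w].
  have [_ <-] := gP u (mem_head _ _).
  have [|_ <-] := gP v; first by rewrite !inE eqxx orbT.
  have [|_ <-] := gP w; first by rewrite !inE eqxx !orbT.
  by rewrite !val_vact act_side.
have hk : h \in kaleidoscopic_set c Gamma.
  apply/asboolP => v.
  have [s sP] := discrete_fixator Gamma_discrete.
  have /choice[w wP] i := branch_color v i.
  have sG g : sigma c (val g) v \in Gamma by have /asboolP := valP g; exact.
  have [g0 g0P] := approx (v :: map w s).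
  suff -> : sigma c h v = sigma c (val g0) v by [].
  apply: sigma_ext => u.
  (* While [g0] does not depend on [u], [g1] also agrees with [f] at [u]. Their local actions at [v]
     agree on the finite set [s], hence are equal, so the colour of the image of [u] can be computed
     with [g1]. *)
  have [g1 g1P] := approx [:: v, u & map w s].
  have fvE g : vact g v = f v -> homeo_branch h v = homeo_branch (val g) v.
    by move=> gv; apply: val_inj; rewrite /= hf -gv.
  have -> : sigma c (val g0) v = sigma c (val g1) v.
    apply/esym/(@mulgI _ (sigma c (val g0) v)^-1%g); rewrite mulVg.
    apply: sP; first by rewrite gpredM ?gpredV//; exact: sG.
    move=> i si; have [g0v _] := g0P v (mem_head _ _).
    have [g1v _] := g1P v (mem_head _ _).
    have [|g0i _] := g0P (w i); first by rewrite inE map_f ?orbT.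
    have [|g1i _] := g1P (w i); first by rewrite !inE map_f ?orbT.
    suff e : sigma c (val g1) v i = sigma c (val g0) v i.
      by rewrite -[RHS](bij_funK (sigma c (val g0) v)) -e.
    have e0 := sigma_vact g0 v (val (w i)); rewrite wP -val_vact g0v g0i in e0.
    have e1 := sigma_vact g1 v (val (w i)); rewrite wP -val_vact g1v g1i in e1.
    by have [] : Some (sigma c (val g1) v i) = Some (sigma c (val g0) v i) :=
      etrans (esym e1) e0.
  have [g1v _] := g1P v (mem_head _ _).
  have [|g1u _] := g1P u; first by rewrite !inE eqxx orbT.
  by rewrite (fvE g1 g1v) hf -g1u -sigma_vact.
exists (exist (fun h : Homeo X => h \in kaleidoscopic_set c Gamma) h hk) => v.
set g := exist _ _ _; have gf u : vact g u = f u by apply: val_inj; exact: hf.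
by split; rewrite // -[in LHS](f'K v) -gf vactVK.
Qed.

Definition agree (s : seq V) g h := forall v, v \in s -> vact h v = vact g v.

Definition pw_open : set_system G :=
  [set U | forall g, U g -> exists s, forall h, agree s g h -> U h].

Lemma pw_openT : pw_open setT.
Proof. by move=> g _; exists [::]. Qed.

Lemma pw_openI : setI_closed pw_open.
Proof.
move=> A B oA oB g [/oA[s sA] /oB[t tB]]; exists (s ++ t) => h gh.
by split; [apply: sA|apply: tB] => v vs; apply: gh; rewrite mem_cat vs ?orbT.
Qed.

Lemma pw_open_bigU (F : set_system G) :
  F `<=` pw_open -> pw_open (\bigcup_(A in F) A).
Proof.
move=> FO g [A FA Ag]; have [s sA] := FO A FA g Ag.
by exists s => h /sA Ah; exists A.
Qed.

Definition pw_topology : topology_on G :=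
  TopologyOn pw_openT pw_openI pw_open_bigU.

Let T := with_topology pw_topology.

Lemma pw_nbhsP g (U : set G) :
  nbhs (g : T) U <-> exists s, forall h, agree s g h -> U h.
Proof.
rewrite nbhsE; split=> [[Z [oZ Zg] ZU]|[s sU]].
  by have [s sZ] := oZ g Zg; exists s => h /sZ/ZU.
exists [set h | agree s g h]; last by move=> h /sU.
split=> //; suff : pw_open [set h | agree s g h] by [].
by move=> h gh; exists s => k hk v vs; rewrite (hk v vs) gh.
Qed.

Lemma pw_mul_continuous : continuous (fun p : T * T => (p.1 * p.2)%g : T).
Proof.
move=> [g h] U /= /pw_nbhsP[s sU].
exists ([set g' : G | agree (map (vact h) s) g g'],
        [set h' : G | agree s h h']) => /=.
  by split; apply/pw_nbhsP; [exists (map (vact h) s)|exists s].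
move=> [g' h'] /= [gg' hh']; apply: sU => v vs.
by rewrite !vactM (hh' v vs) gg'// map_f.
Qed.

Lemma pw_inv_continuous : continuous (fun g : T => (g^-1)%g : T).
Proof.
move=> g U /= /pw_nbhsP[s sU].
apply/pw_nbhsP; exists (map (vact g^-1%g) s) => h gh /=.
apply: sU => v vs; apply: (can_inj (vactVK h)).
by rewrite vactKV gh ?map_f// vactKV.
Qed.

Lemma pw_separable : separable T.
Proof.
have [e e_surj] := branch_enum.
(* A list [t] encodes finitely many conditions on an element; [r t] satisfies them if any element
   does, and is 1 otherwise. *)
have /choice[r rP] (t : seq (nat * nat)) : exists g, forall h,
    (forall a, a \in t -> vact h (e a.1) = e a.2) ->
    forall a, a \in t -> vact g (e a.1) = e a.2.
  have [[h hP]|no] := pselect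
      (exists h, forall a, a \in t -> vact h (e a.1) = e a.2).
    by exists h.
  by exists 1%g => h hP; case: no; exists h.
exists (range r).
  exact: (@card_le_trans _ _ _ [set: seq (nat * nat)] _ _
    (card_image_le r _) (countableP _)).
move=> U [g Ug] oU; have [s sU] := oU g Ug.
have /choice[k kP] v := e_surj v.
pose t := [seq (k v, k (vact g v)) | v <- s].
exists (r t); split; last by exists t.
apply: sU => v vs.
have := rP t g _ (k v, k (vact g v)); rewrite /= !kP; apply.
  by move=> _ /mapP[w ws ->] /=; rewrite !kP.
by apply/mapP; exists v.
Qed.

Lemma pw_polish :
  discrete_subset [set` Gamma] -> polish_group_topology R pw_topology.
Proof.
move=> Gd; split.
- exact: pw_mul_continuous.
- exact: pw_inv_continuous.
- exact: pw_separable.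
have [e e_surj] := branch_enum; have /choice[k kP] v := e_surj v.
(* Recording the inverse as well makes the metric complete. *)
pose F g i := (vact g (e i), vact g^-1%g (e i)).
have F_inj g h : (forall i, F g i = F h i) -> g = h.
  move=> gh; apply: act_faithful => v; have [i <-] := e_surj v.
  exact: (congr1 fst (gh i)).
have bound (s : seq V) : exists N, forall v, v \in s -> (k v <= N)%N.
  elim: s => [|v s [N NP]]; first by exists 0%N.
  exists (maxn (k v) N) => w; rewrite inE => /predU1P[->|/NP h].
    exact: leq_maxl.
  by rewrite leq_max h orbT.
apply: (@seq_completely_metrizable R G _ F F_inj pw_topology) => [g U|f approx].
  split=> [/pw_nbhsP[s sU]|[N NU]].
    have [N NP] := bound s; exists N => h gh; apply: sU => v vs.
    by have /(congr1 fst) := gh (k v) (NP v vs); rewrite /F /= kP => ->.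
  apply/pw_nbhsP.
  (* Agreement at the preimage of [e i] under [g] makes the inverses agree at [e i]. *)
  exists (map e (iota 0 N.+1) ++ map (vact g^-1%g \o e) (iota 0 N.+1)).
  move=> h gh; apply: NU => i iN; rewrite /F.
  have iI : i \in iota 0 N.+1 by rewrite mem_iota.
  rewrite (gh (e i)); last by rewrite mem_cat map_f.
  congr (_, _); apply: (can_inj (vactVK h)); rewrite vactKV.
  rewrite gh ?vactKV// mem_cat; apply/orP; right.
  by apply/mapP; exists i.
have [s|g gP] := @kaleidoscopic_closed Gd
    (fun v => (f (k v)).1) (fun v => (f (k v)).2).
  have [N NP] := bound s; have [x xP] := approx N; exists x => v vs.
  by rewrite -xP ?NP//= kP.
exists g => i; have [x xP] := approx (maxn i (k (e i))).
rewrite /F; have [-> ->] := gP (e i).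
by rewrite -!xP ?leq_maxl ?leq_maxr// /F kP.
Qed.

(** * Algebraically definable open subgroups *)

Lemma Dn_half_space p (U : set X) : nbhs p U ->
  exists v y, y <> val v /\ side (val v) y `<=` U.
Proof.
have [[a b] ab] := two_points.
move=> /(half_space_sub Dn_hausdorff Dn_compact Dn_connected Dn_loc_connected
  branch_separation ab (@branch_point_three X))[w [y [Bw yw wU]]].
by exists (exist (fun y => y \in @branch_points X) w (mem_set Bw)), y.
Qed.

Lemma mover_in (U : set X) p : nbhs p U -> exists r,
  (forall q, ~ U q -> act r q = q) /\ exists2 q, U q & act r q <> q.
Proof.
move=> /Dn_half_space[v [y [yv vU]]].
have [r [r_out [q yq rq]]] := half_space_mover yv.
exists r; split; last by exists q => //; exact: vU.
by move=> z nUz; apply: r_out => /vU.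
Qed.

Definition fixator (A : set X) : set G :=
  [set g | forall p, A p -> act g p = p].

(** If [g] moves a point [p] of [A], some neighbourhood [U] of [p] in [A] is disjoint from its
    image. An [r] supported in [U] and moving a point [q] fixes [act g q], so it does not commute
    with [g]. *)
Lemma fixator_centralizer (A : set X) : open A ->
  fixator A = [set g | forall r, fixator (~` A) r -> (g * r = r * g)%g].
Proof.
move=> oA; apply/seteqP; split=> [g gA r rA|g gP p Ap].
  have g_out p : ~ A p -> ~ A (act g p).
    by move=> nAp Agp; apply: nAp; have /act_inj := gA _ Agp => <-.
  have r_in p : A p -> A (act r p).
    move=> Ap; apply: contrapT => nArp.
    by have /act_inj e := rA _ nArp; apply: nArp; rewrite e.
  apply: act_faithful => v; apply: val_inj; rewrite !val_vact !actM.
  have [Av|nAv] := pselect (A (val v)).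
    by rewrite (gA _ (r_in _ Av)) (gA _ Av).
  by rewrite (rA _ nAv) (rA _ (g_out _ nAv)).
apply: contrapT => gp.
have [U [Up UA gU]] :
    exists U, [/\ nbhs p U, U `<=` A & forall q, U q -> ~ U (act g q)].
  apply: contrapT => no; apply: gp; apply: Dn_hausdorff => P Q nP nQ.
  apply: contrapT => PQ; apply: no.
  exists ([set q | P (act g q)] `&` (Q `&` A)); split.
  - apply: filterI; first exact: (act_continuous nP).
    by apply: filterI => //; apply: open_nbhs_nbhs.
  - by move=> q [_ []].
  - by move=> q [Pq _] [_ [Qq _]]; apply: PQ; exists (act g q).
have [r [r_out [q Uq rq]]] := mover_in Up.
have /gP e : fixator (~` A) r.
  by move=> z nAz; apply: r_out => /UA.
apply: rq; apply: (@act_inj g); rewrite -actM e actM.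
exact/r_out/gU.
Qed.

(** At a point of the first half-space outside the closure of the second, a small mover would be in
    the second fixator but not in the first. *)
Lemma fixator_sub_closure v y v' y' : y <> val v -> y' <> val v' ->
  fixator (side (val v') y') `<=` fixator (side (val v) y) ->
  side (val v) y `<=` side (val v') y' `|` [set val v'].
Proof.
move=> yv yv' sub z yz; apply: contrapT => /not_orP[nz zv'].
have zU : nbhs z (side (val v) y `&` side (val v') z).
  by apply: filterI; apply: Dn_side_nbhs => //; exact: side_refl.
have [r [r_out [q [yq _] rq]]] := mover_in zU.
apply: rq; apply: sub => // t y't; apply: r_out => -[_ zt].
by apply: nz; exact: side_trans y't (side_sym zt).
Qed.

Lemma branch_not_interior v y (U : set X) : nbhs (val v) U ->
  ~ (U `<=` side (val v) y `|` [set val v]).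
Proof.
move=> vU sub.
have [t [_ [tv _ yt _ _]]] := branch_point_three y (set_mem (valP v)).
have [z [tz Uz]] :=
  side_open_meet Dn_hausdorff Dn_connected Dn_loc_connected tv vU.
have [yz|zv] := sub z Uz.
  by apply: yt; exact: side_trans yz (side_sym tz).
exact: (side_neq tz).
Qed.

(** The two half-spaces have the same closure. A branch point has further sides, so neither cut
    point is interior to this closure; if the cut points differed, [val v'] would be in the closure
    of the first half-space but neither in it nor equal to [val v]. *)
Lemma fixator_half_space v y v' y' : y <> val v -> y' <> val v' ->
  fixator (side (val v) y) = fixator (side (val v') y') -> v = v'.
Proof.
move=> yv yv' e; apply: contrapT => vv'.
have sub1 : side (val v) y `<=` side (val v') y' `|` [set val v'].
  by apply: fixator_sub_closure => //; rewrite e.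
have sub2 : side (val v') y' `<=` side (val v) y `|` [set val v].
  by apply: fixator_sub_closure => //; rewrite e.
have n1 : ~ side (val v') y' (val v).
  by move=> h; apply: (@branch_not_interior v y _ (Dn_side_nbhs h)).
have n2 : ~ side (val v) y (val v').
  by move=> h; apply: (@branch_not_interior v' y' _ (Dn_side_nbhs h)).
have sub3 : side (val v') y' `<=` side (val v) y.
  by move=> z yz; have [//|zv] := sub2 z yz; case: n1; rewrite -zv.
have := side_closure Dn_hausdorff Dn_connected Dn_loc_connected yv'.
move=> /(closureS sub3)/(closure_side Dn_hausdorff Dn_loc_connected)[//|].
by move/val_inj/esym.
Qed.

(** * Every Polish group topology refines the pointwise one *)

Section Uniqueness.
Variable tau : topology_on G.
Hypothesis tau_polish : polish_group_topology R tau.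
Let S := with_topology tau.

Let closed_comm r : closed ([set g | (g * r = r * g)%g] : set S).
Proof.
move=> g cg; apply: (gt_hausdorff tau_polish) => P Q.
move=> /(gt_mulr tau_polish) nP /(gt_mull tau_polish) nQ.
have [h [e [Ph Qh]]] := cg _ (gt_nbhsI nP nQ).
by exists (h * r)%g; split=> //; rewrite e.
Qed.

Let closed_fixator (A : set X) : open A -> closed (fixator A : set S).
Proof.
move=> oA; rewrite fixator_centralizer//.
have -> : [set g | forall r, fixator (~` A) r -> (g * r = r * g)%g] =
    \bigcap_(r in fixator (~` A)) [set g | (g * r = r * g)%g].
  by apply/seteqP; split=> g gP r /gP.
by apply: (@closed_bigI S) => r _; exact: closed_comm.
Qed.

Let conj_nbhs (a g : G) (U : set G) : nbhs ((g * a * g^-1)%g : S) U ->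
  nbhs (g : S) [set h | U (h * a * h^-1)%g].
Proof.
move=> /(gt_mul tau_polish)[P [Q [/(gt_mulr tau_polish) nP + PQ]]].
move=> /(gt_inv tau_polish) nQ.
by apply: filterS (gt_nbhsI nP nQ) => h [Ph Qh]; exact: PQ.
Qed.

Let conjV_nbhs (a g : G) (U : set G) : nbhs ((g^-1 * a * g)%g : S) U ->
  nbhs (g : S) [set h | U (h^-1 * a * h)%g].
Proof.
move=> /(gt_mul tau_polish)[P [Q [/(gt_mulr tau_polish) + nQ PQ]]].
move=> /(gt_inv tau_polish) nP.
by apply: filterS (gt_nbhsI nP nQ) => h [Ph Qh]; exact: PQ.
Qed.

Let stabilizer_nbhs v : nbhs (1%g : S) [set g | vact g v = v].
Proof.
have [y yv] : exists y, y <> val v.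
  have [[a b] ab] := two_points.
  have [e|/eqP ne] := eqVneq a (val v); last by exists a.
  by exists b => e'; apply: ab; rewrite /= e e'.
have [b yb] := branch_in_side yv.
pose H := fixator (side (val v) y).
(* The normalizer of [H]; a single inclusion need not be stable under inverses. *)
pose N : set G :=
  [set g | forall a, H a -> H (g * a * g^-1)%g /\ H (g^-1 * a * g)%g].
have cH : closed (H : set S).
  by apply: closed_fixator; exact: side_open Dn_hausdorff Dn_loc_connected _ _.
have N_closed : closed (N : set S).
  move=> g cg a Ha; split; apply: cH => U.
    by move=> /conj_nbhs/cg[h [/(_ a Ha)[Hh _] Uh]]; exists (h * a * h^-1)%g.
  by move=> /conjV_nbhs/cg[h [/(_ a Ha)[_ Hh] Uh]]; exists (h^-1 * a * h)%g.
have N_sub g h : N g -> N h -> N (g^-1 * h)%g.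
  move=> Ng Nh a Ha; split.
    have -> : (g^-1 * h * a * (g^-1 * h)^-1)%g = (g^-1 * (h * a * h^-1) * g)%g.
      by rewrite invgM invgK !mulgA.
    by have [_] := Ng _ (Nh _ Ha).1.
  have -> : ((g^-1 * h)^-1 * a * (g^-1 * h))%g = (h^-1 * (g * a * g^-1) * h)%g.
    by rewrite invgM invgK !mulgA.
  by have [_] := Nh _ (Ng _ Ha).1.
have stab_conj g a : vact g v = v -> vact g b = b -> H a -> H (g * a * g^-1)%g.
  move=> gv gb Ha p yp; rewrite !actM.
  suff h : side (val v) y (act g^-1%g p) by rewrite (Ha _ h) actKV.
  apply: (side_trans yb); rewrite -(act_side g) actKV -!val_vact gv gb.
  exact: side_trans (side_sym yb) yp.
have vactV_fix g u : vact g u = u -> vact g^-1%g u = u.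
  by move=> gu; rewrite -{1}gu vactVK.
have N_stab g : vact g v = v -> vact g b = b -> N g.
  move=> gv gb a Ha; split; first exact: stab_conj.
  by rewrite -{2}[g]invgK; apply: stab_conj => //; exact: vactV_fix.
have [e e_surj] := branch_enum.
(* An element fixing [v] and the branch point [b] preserves the half-space, so a coset of [N] is
   determined by the images of [v] and [b]; [r] chooses representatives. *)
have /choice[r rP] (t : nat * nat) : exists g, forall h,
    vact h v = e t.1 -> vact h b = e t.2 ->
    vact g v = e t.1 /\ vact g b = e t.2.
  have [[h [hv hb]]|no] := pselect
      (exists h, vact h v = e t.1 /\ vact h b = e t.2).
    by exists h.
  by exists 1%g => h hv hb; case: no; exists h.
have N_open : open (N : set S).
  apply: (@countable_index_open R _ _ tau_polish N
    (fun k => if unpickle k is Some t then r t else 1%g)) => //.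
  move=> g; have [i ei] := e_surj (vact g v); have [j ej] := e_surj (vact g b).
  exists (pickle (i, j)); rewrite pickleK.
  have [rv rb] := rP (i, j) g (esym ei) (esym ej).
  by apply: N_stab; rewrite vactM;
    [rewrite -ei -rv|rewrite -ej -rb]; rewrite vactVK.
have N1 : N 1%g by apply: N_stab; exact: vact1.
apply: filterS (open_nbhs_nbhs (conj N_open N1)) => g Ng /=.
have gyv : act g y <> val (vact g v) by move/act_inj.
apply/esym; apply: (fixator_half_space yv gyv).
(* Conjugating [H] by [g] gives the fixator of the translated half-space, so for [g] in [N] both
   half-spaces have the same fixator, hence the same cut point. *)
have gH a : fixator (side (val (vact g v)) (act g y)) a <-> H (g^-1 * a * g)%g.
  split=> [Ha p yp|Ha p].
    by rewrite !actM Ha ?actVK// val_vact act_side.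
  rewrite val_vact -{1}[p](actKV g) act_side => /Ha.
  by rewrite !actM actKV => /(congr1 (act g)); rewrite !actKV.
apply/seteqP; split=> a; first by move=> Ha; apply/gH; have [] := Ng _ Ha.
move=> /gH/Ng[+ _]; by rewrite !mulgA mulgV mul1g mulgK.
Qed.

Lemma pw_coarser : top_open pw_topology `<=` top_open tau.
Proof.
move=> U oU; suff : open (U : set S) by [].
rewrite openE => g /oU[s sU].
apply: (@filterS S _ _ [set h | forall v, v \in s -> vact h v = vact g v]).
  by move=> h hs; exact: sU.
apply: (@filter_seq_forall S V _ _ s
  (fun v => [set h | vact h v = vact g v])) => v _.
have := stabilizer_nbhs v; rewrite -(mulVg g).
move=> /(gt_mull tau_polish); apply: filterS => h /=.
by rewrite vactM => /(congr1 (vact g)); rewrite vactKV.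
Qed.

End Uniqueness.

Lemma polish_topology_unique : discrete_subset [set` Gamma] ->
  exists! tau : topology_on G, polish_group_topology R tau.
Proof.
move=> Gd; exists pw_topology; split; first exact: pw_polish.
move=> tau tau_polish; apply: (polish_comparable (pw_polish Gd) tau_polish).
exact: pw_coarser.
Qed.

End Group.
End Wazewski.

Theorem theorem1p10 (R : realType) (n : option nat)
  (n_ge3 : if n is Some k then (3 <= k)%N else true)
  (X : topologicalType) (X_Dn : wazewski_dendrite R n X)
  (c : coloring n X) (c_kaleidoscopic : kaleidoscopic R c)
  (Gamma : groupClosed (sym n))
  (Gamma_discrete : discrete_subset [set` Gamma]) :
  exists! tau : topology_on (kaleidoscopic_group c Gamma),
    polish_group_topology R tau.
Proof.
exact: (polish_topology_unique n_ge3 X_Dn c_kaleidoscopic Gamma_discrete).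
Qed.
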